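(* Let $\mathfrak t$ be a semibounded sesquilinear form in a complex Hilbert space $\mathfrak H$. Then $\mathfrak t$ has a sum decomposition $$\mathfrak t=\mathfrak t_{\rm reg}+\mathfrak t_{\rm sing},\qquad\operatorname{dom}\mathfrak t=\operatorname{dom}\mathfrak t_{\rm reg}=\operatorname{dom}\mathfrak t_{\rm sing},$$ with a closable semibounded form $\mathfrak t_{\rm reg}$ and a singular nonnegative form $\mathfrak t_{\rm sing}$ in $\mathfrak H$. In fact, let $c\le m(\mathfrak t)$ and let $Q$ be a linear operator from $\mathfrak H$ to a Hilbert space $\mathfrak K$ with $\operatorname{dom}Q=\operatorname{dom}\mathfrak t$ and $$\mathfrak t[\varphi,\psi]=c(\varphi,\psi)+(Q\varphi,Q\psi),\qquad\varphi,\psi\in\operatorname{dom}\mathfrak t .$$ Let $P_0$ be the orthogonal projection from $\mathfrak K$ onto $\operatorname{mul}Q^{**}$ and put $Q_{\rm reg}=(I-P_0)Q$, $Q_{\rm sing}=P_0Q$. Then such a decomposition is given by $$\mathfrak t_{\rm reg}[\varphi,\psi]=c(\varphi,\psi)+(Q_{\rm reg}\varphi,Q_{\rm reg}\psi),\qquad \mathfrak t_{\rm sing}[\varphi,\psi]=(Q_{\rm sing}\varphi,Q_{\rm sing}\psi),\qquad\varphi,\psi\in\operatorname{dom}\mathfrak t=\operatorname{dom}Q .$$ Moreover, the closure $\overline{\mathfrak t_{\rm reg}}$ of the closable part $\mathfrak t_{\rm reg}$ is given by $$\overline{\mathfrak t_{\rm reg}}[\varphi,\psi]=c(\varphi,\psi)+((Q_{\rm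 reg})^{**}\varphi,(Q_{\rm reg})^{**}\psi),\qquad\varphi,\psi\in\operatorname{dom}\overline{\mathfrak t_{\rm reg}}=\operatorname{dom}Q^{**}.$$
   Context: A (sesquilinear) form $\mathfrak t$ in $\mathfrak H$ is a map $\operatorname{dom}\mathfrak t\times\operatorname{dom}\mathfrak t\to\mathbb C$, linear in the first and antilinear in the second entry, where $\operatorname{dom}\mathfrak t$ is a (not necessarily dense) linear subspace of $\mathfrak H$; $\mathfrak t[\varphi]=\mathfrak t[\varphi,\varphi]$. It is semibounded if there is $c\in\mathbb R$ with $\mathfrak t[\varphi]\ge c\|\varphi\|^2$ on $\operatorname{dom}\mathfrak t$; the greatest such $c$ is the lower bound $m(\mathfrak t)\in\mathbb R$ (so $\operatorname{dom}\mathfrak t\neq\{0\}$ is understood). It is nonnegative if $\mathfrak t[\varphi]\ge0$ on $\operatorname{dom}\mathfrak t$. The sum of two forms is defined pointwise on the intersection of the domains. An operator $Q$ as in the claim (a representing map for $\mathfrak t-c$) always exists. For $\varphi_n\in\operatorname{dom}\mathfrak t$, $\varphi_n\to_{\mathfrak t}\varphi$ means $\varphi_n\to\varphi$ in $\mathfrak H$ and $\mathfrak t[\varphi_n-\varphi_m]\to0$. A semibounded form $\mathfrak t$ is closable if $\varphi_n\to_{\mathfrak t}0$ implies $\mathfrak t[\varphi_n]\to0$; it is closed if $\varphi_n\to_{\mathfrak t}\varphi$ implies $\varphi\in\operatorname{dom}\mathfrak t$ and $\mathfrak t[\varphi_n-\varphi]\to0$. The closure of a closable semibounded form is its smallest closed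 extension. A nonnegative form $\mathfrak t$ is singular if for every $\varphi\in\operatorname{dom}\mathfrak t$ there is a sequence $\varphi_n\in\operatorname{dom}\mathfrak t$ with $\varphi_n\to\varphi$ in $\mathfrak H$ and $\mathfrak t[\varphi_n]\to0$. For a linear operator $T$ from $\mathfrak H$ to $\mathfrak K$ (not necessarily densely defined or closable), $T^{**}\subset\mathfrak H\times\mathfrak K$ is the closure of its graph, a closed linear relation, with $\operatorname{dom}T^{**}=\{\varphi:\{\varphi,g\}\in T^{**}\text{ for some }g\}$ and $\operatorname{mul}T^{**}=\{\omega:\{0,\omega\}\in T^{**}\}$, a closed subspace of $\mathfrak K$. The operator $Q_{\rm reg}$ is closable, so $(Q_{\rm reg})^{**}$ is (the graph of) an operator. *)

(* Defs.v *)
From HB Require Import structures.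
From mathcomp Require Import all_boot all_order all_algebra.
From mathcomp Require Export complex.
From mathcomp Require Import all_classical all_reals.
From mathcomp Require Import topology normedtype sequences.

Set Implicit Arguments.
Unset Strict Implicit.
Unset Printing Implicit Defensive.

Import Order.TTheory GRing.Theory Num.Theory.
Import numFieldNormedType.Exports.

Local Open Scope classical_set_scope.
Local Open Scope ring_scope.
Local Open Scope complex_scope.

(* The inner product is linear in its first and antilinear in its second
   argument. *)
HB.mixin Record CompleteNormedModule_isHilbert (R : realType) H
    of CompleteNormedModule R[i] H := {
  inner : {dot H for @Num.conj R[i]} ;
  normr_inner : forall x : H, `|x| ^+ 2 = inner x x
}.

#[short(type="hilbertType")]
HB.structure Definition Hilbert (R : realType) :=
  { H of CompleteNormedModule R[i] H & CompleteNormedModule_isHilbert R H }.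

Definition subspace (K : nzRingType) (V : lmodType K) (D : set V) : Prop :=
  D 0 /\ forall a x y, D x -> D y -> D (a *: x + y).

Section Forms.
Context (R : realType) (H : hilbertType R).

(* A partially defined form: [sval] is only meaningful on [sdom], and every
   notion below, including equality [sform_eq], looks at [sdom] only. *)
Record sform := SForm { sdom : set H ; sval :> H -> H -> R[i] }.

Implicit Types (s t u : sform) (x y z : H) (c : R).

Definition sesquilinear t : Prop :=
  [/\ subspace (sdom t),
      forall a x y z, sdom t x -> sdom t y -> sdom t z ->
        t (a *: x + y) z = a * t x z + t y z &
      forall a x y z, sdom t x -> sdom t y -> sdom t z ->
        t z (a *: x + y) = a^* * t z x + t z y].

(* The order of [R[i]] is partial: [a <= b] entails that [b - a] is real, so
   these bounds include that [t x x] is real. *)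
Definition bounded_below_by t c : Prop :=
  forall x, sdom t x -> c%:C * `|x| ^+ 2 <= t x x.

Definition semibounded t : Prop := exists c, bounded_below_by t c.

(* For a semibounded form with nonzero domain the set is nonempty, bounded
   above and contains its supremum; for a zero domain the value is junk. *)
Definition lower_bound t : R := sup [set c | bounded_below_by t c].

Definition nonnegative t : Prop := forall x, sdom t x -> 0 <= t x x.

Definition form_cvg t (f : nat -> H) x : Prop :=
  [/\ forall n, sdom t (f n),
      f n @[n --> \oo] --> x &
      (t (f p.1 - f p.2) (f p.1 - f p.2) : R[i]^o) @[p --> (\oo, \oo)] -->
        (0 : R[i]^o)].

Definition closable t : Prop :=
  forall f, form_cvg t f 0 ->
    (t (f n) (f n) : R[i]^o) @[n --> \oo] --> (0 : R[i]^o).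

Definition form_closed t : Prop :=
  forall f x, form_cvg t f x ->
    sdom t x /\
    (t (f n - x) (f n - x) : R[i]^o) @[n --> \oo] --> (0 : R[i]^o).

Definition singular t : Prop :=
  forall x, sdom t x -> exists f : nat -> H,
    [/\ forall n, sdom t (f n),
        f n @[n --> \oo] --> x &
        (t (f n) (f n) : R[i]^o) @[n --> \oo] --> (0 : R[i]^o)].

Definition extends t s : Prop :=
  sdom s `<=` sdom t /\
  forall x y, sdom s x -> sdom s y -> t x y = s x y.

Definition sform_eq s t : Prop :=
  sdom s = sdom t /\ forall x y, sdom s x -> sdom s y -> s x y = t x y.

Definition sform_add s t : sform :=
  SForm (sdom s `&` sdom t) (fun x y => s x y + t x y).

Definition is_form_closure s t : Prop :=
  [/\ sesquilinear s, semibounded s, form_closed s, extends s t &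
      forall u, sesquilinear u -> semibounded u -> form_closed u ->
        extends u t -> extends u s].

Definition sum_decomposition t treg tsing : Prop :=
  [/\ sform_eq t (sform_add treg tsing),
      sdom t = sdom treg /\ sdom t = sdom tsing,
      [/\ sesquilinear treg, semibounded treg & closable treg] &
      [/\ sesquilinear tsing, nonnegative tsing & singular tsing]].

(* The orthogonal projection onto a closed subspace [M]. *)
Definition orthoproj (M : set H) x : H :=
  xget 0 [set p | M p /\ forall y, M y -> inner (x - p) y = 0].

End Forms.

Section Operators.
Context (R : realType) (H K : hilbertType R).

(* A partially defined operator; [oval] is only meaningful on [odom]. *)
Record operator := Operator { odom : set H ; oval :> H -> K }.

Implicit Types (T : operator) (G : set (H * K)).

Definition linear_operator T : Prop :=
  subspace (odom T) /\
  forall a x y, odom T x -> odom T y -> T (a *: x + y) = a *: T x + T y.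

Definition graph T : set (H * K) := [set p | odom T p.1 /\ p.2 = T p.1].

(* [T**], the closure of the graph in the product topology. *)
Definition biadjoint T : set (H * K) := closure (graph T).

Definition rel_dom G : set H := [set x | exists y, G (x, y)].

Definition rel_mul G : set K := [set w | G (0, w)].

(* When [rel_mul G = [set 0]], the operator whose graph is the linear
   relation [G]. *)
Definition rel_operator G : operator :=
  Operator (rel_dom G) (fun x => xget 0 [set y | G (x, y)]).

Definition reg_part T : operator :=
  Operator (odom T) (fun x => T x - orthoproj (rel_mul (biadjoint T)) (T x)).

Definition sing_part T : operator :=
  Operator (odom T) (fun x => orthoproj (rel_mul (biadjoint T)) (T x)).

End Operators.

(* Main.v *)
(** Write [G] for the closure of the graph of [Q] and [M] for its multivalued
part. The closure of the graph of [Q_reg] is the part of [G] with values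
orthogonal to [M]; hence it is single-valued, and it has the domain of [G] since
one may subtract [P0 y] from [y] within [G]. Closability of [t_reg] and its closure
follow, as convergence for [c (x, y) + (T x, T y)] is convergence in the graph of
[T]. Singularity holds because [{0, P0 Q x}] lies in [G]: there are [h_n -> 0]
with [Q h_n -> P0 Q x], and then [x - h_n -> x] with [Q_sing (x - h_n) -> 0].
A closed semibounded extension of [t_reg] contains the limits of all sequences
converging for [t_reg], with the right values by the Cauchy-Schwarz inequality.
The existence of a representing map, needed for the first assertion, is the
completion of the semi-inner product space [(dom t, t - c)]. *)

From HB Require Import structures.
Require Import Defs.
From mathcomp Require Import all_boot all_order all_algebra.
From mathcomp Require Import all_classical all_reals.
From mathcomp Require Import topology normedtype sequences.
From mathcomp Require Import ring lra.

Set Implicit Arguments.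
Unset Strict Implicit.
Unset Printing Implicit Defensive.

Import Order.TTheory GRing.Theory Num.Theory.
Import numFieldNormedType.Exports.
Local Open Scope classical_set_scope.
Local Open Scope ring_scope.

(** * Closure properties of linear subspaces *)

Section Subspace.
Context (K : nzRingType) (V : lmodType K) (D : set V) (D_sub : Defs.subspace D).
Implicit Types x y : V.

Lemma subspace0 : D 0. Proof. by case: D_sub. Qed.

Lemma subspaceD x y : D x -> D y -> D (x + y).
Proof. by case: D_sub => _ D_lin Dx Dy; rewrite -[x]scale1r; apply: D_lin. Qed.

Lemma subspaceZ a x : D x -> D (a *: x).
Proof. by case: D_sub => D0 D_lin Dx; rewrite -[_ *: x]addr0; apply: D_lin. Qed.

Lemma subspaceB x y : D x -> D y -> D (x - y).
Proof. by move=> Dx Dy; rewrite -scaleN1r; apply/subspaceD/subspaceZ. Qed.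

End Subspace.

(** * Sesquilinear forms on a subspace *)

Section Sesqui.
Context (C : numClosedFieldType) (V : lmodType C).
Implicit Types (D : set V) (s : V -> V -> C).

(** The clauses of [sesquilinear] on a space without a norm, so that one Cauchy-Schwarz inequality
    serves the inner products, the shifted form [t - c] and the inner product of the completion. *)
Definition sesqui_on D s : Prop :=
  [/\ Defs.subspace D,
      forall a x y z, D x -> D y -> D z -> s (a *: x + y) z = a * s x z + s y z &
      forall a x y z, D x -> D y -> D z ->
        s z (a *: x + y) = a^* * s z x + s z y].

Context (D : set V) (s : V -> V -> C) (s_sesqui : sesqui_on D s).

Let D_sub : Defs.subspace D. Proof. by case: s_sesqui. Qed.

Local Notation N x := (sqrtC (s x x)).

Lemma sesquiDl x y z : D x -> D y -> D z -> s (x + y) z = s x z + s y z.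
Proof.
by case: s_sesqui => _ s_l _ Dx Dy Dz; rewrite -[x]scale1r s_l// mul1r scale1r.
Qed.

Lemma sesquiZl a x z : D x -> D z -> s (a *: x) z = a * s x z.
Proof.
case: s_sesqui => _ s_l _ Dx Dz; have D0 := subspace0 D_sub.
have s0 : s 0 z = 0.
  by have := s_l (-1) 0 0 z D0 D0 Dz; rewrite scaler0 addr0 mulN1r addNr.
by rewrite -[a *: x]addr0 s_l// s0 addr0.
Qed.

Lemma sesquiBl x y z : D x -> D y -> D z -> s (x - y) z = s x z - s y z.
Proof.
move=> Dx Dy Dz; rewrite -scaleN1r sesquiDl ?sesquiZl ?mulN1r//.
exact: subspaceZ.
Qed.

Lemma sesquiDr x y z : D x -> D y -> D z -> s z (x + y) = s z x + s z y.
Proof.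
case: s_sesqui => _ _ s_r Dx Dy Dz.
by rewrite -[x]scale1r s_r// rmorph1 mul1r scale1r.
Qed.

Lemma sesquiZr a x z : D x -> D z -> s z (a *: x) = a^* * s z x.
Proof.
case: s_sesqui => _ _ s_r Dx Dz; have D0 := subspace0 D_sub.
have s0 : s z 0 = 0.
  have := s_r (-1) 0 0 z D0 D0 Dz.
  by rewrite scaler0 addr0 rmorphN1 mulN1r addNr.
by rewrite -[a *: x]addr0 s_r// s0 addr0.
Qed.

Lemma sesquiBr x y z : D x -> D y -> D z -> s z (x - y) = s z x - s z y.
Proof.
move=> Dx Dy Dz; rewrite -scaleN1r sesquiDr ?sesquiZr ?rmorphN1 ?mulN1r//.
exact: subspaceZ.
Qed.

Context (s_ge0 : forall x, D x -> 0 <= s x x).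

(* Both [s x y + s y x] and ['i * (s y x - s x y)] are real, being read off
   [s] at [x + y] and [x + 'i *: y]. *)
Lemma sesqui_conj x y : D x -> D y -> (s x y)^* = s y x.
Proof.
move=> Dx Dy.
have D1 : D (x + y) by apply: subspaceD.
have Diy : D ('i%R *: y) by apply: subspaceZ.
have D2 : D (x + 'i%R *: y) by apply: subspaceD.
have conj_s z : D z -> (s z z)^* = s z z.
  by move=> /s_ge0/ger0_real/CrealP.
have e1 := conj_s _ D1; have e2 := conj_s _ D2.
move: e1 e2; rewrite !(sesquiDl, sesquiDr) // !sesquiZl// !sesquiZr//.
rewrite !(rmorphD, rmorphM)/= !conjCi !(conj_s x)// !(conj_s y)// !(rmorphN, conjCi)/=.
set p := s x y; set q := s y x => e1 e2.
have {}e1 : p^* + q^* = p + q.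
  apply: (addrI (s x x)); apply: (addIr (s y y)).
  by move: e1; rewrite !addrA.
have {}e2 : 'i * (p^* - q^*) = 'i * (q - p).
  apply: (addrI (s x x)); apply: (addIr (- 'i * 'i * s y y)).
  move: e2; rewrite conjCi opprK => e2.
  rewrite [LHS](_ : _ = s x x + 'i * p^* + (- 'i * q^* + - 'i * ('i * s y y)));
    last by ring.
  by rewrite e2; ring.
have {}e2 : p^* - q^* = q - p by apply: (mulfI (neq0Ci C)).
apply: (mulfI (_ : 2 != 0 :> C)); first by rewrite pnatr_eq0.
rewrite (_ : 2 * p^* = (p^* + q^*) + (p^* - q^*)); last by ring.
by rewrite e1 e2; ring.
Qed.

Lemma sesqui_sqrB x y a : D x -> D y ->
  s (x - a *: y) (x - a *: y) =
  s x x - a^* * s x y - a * (s x y)^* + a * a^* * s y y.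
Proof.
move=> Dx Dy; have Day : D (a *: y) by apply: subspaceZ.
have Dd : D (x - a *: y) by apply: subspaceB.
rewrite !sesquiBr// !sesquiBl// !sesquiZr// !sesquiZl//.
by rewrite sesqui_conj//; ring.
Qed.

(** The form is nonnegative at [x - (k * s x y) *: y] for every real [k >= 0]. As it is only
    semidefinite, [s y y] may vanish, and the two cases call for different [k]. *)
Lemma cauchy_schwarz x y : D x -> D y -> `|s x y| ^+ 2 <= s x x * s y y.
Proof.
move=> Dx Dy; have sxx := s_ge0 Dx; have syy := s_ge0 Dy.
have pos a : 0 <= s x x - a^* * s x y - a * (s x y)^* + a * a^* * s y y.
  by rewrite -sesqui_sqrB//; apply: s_ge0; apply: subspaceB; last exact: subspaceZ.
have [->|sxy0] := eqVneq (s x y) 0; first by rewrite normr0 expr0n mulr_ge0.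
have p_gt0 : 0 < `|s x y| ^+ 2 by rewrite exprn_gt0// normr_gt0.
have conjk (k : C) : 0 <= k -> k^* = k by move=> /ger0_real/CrealP.
have {}pos (k : C) : 0 <= k ->
    0 <= s x x - k * 2 * `|s x y| ^+ 2 + k ^+ 2 * `|s x y| ^+ 2 * s y y.
  move=> k0; have := pos (k * s x y); rewrite rmorphM/= (conjk k)// normCK.
  by congr (_ <= _); ring.
have [syy0|syy0] := eqVneq (s y y) 0.
  (* With [s y y = 0] the bound is affine in [k]; this choice turns it into [0 <= - (s x x + 2)], a
     contradiction. *)
  have k0 : 0 <= (s x x + 1) / `|s x y| ^+ 2 by rewrite divr_ge0 ?addr_ge0 ?exprn_ge0.
  have := pos _ k0.
  rewrite syy0 mulr0 addr0 mulrAC divfK ?gt_eqF//.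
  rewrite (_ : _ - _ = - (s x x + 2)); last by ring.
  by rewrite oppr_ge0 => /(lt_le_trans (ltr_wpDl sxx (ltr0Sn _ 1))); rewrite ltxx.
have syy_gt0 : 0 < s y y by rewrite lt_def syy0.
(* This [k] minimizes the quadratic polynomial. *)
have := pos (s y y)^-1; rewrite invr_ge0 => /(_ syy).
rewrite (_ : _ + _ = s x x - `|s x y| ^+ 2 / s y y); last by field.
by rewrite subr_ge0 ler_pdivrMr.
Qed.

Lemma cauchy_schwarz_sqrt x y : D x -> D y -> `|s x y| <= N x * N y.
Proof.
move=> Dx Dy; rewrite -(@ler_pXn2r _ 2)// ?nnegrE ?mulr_ge0 ?sqrtC_ge0 ?s_ge0//.
by rewrite exprMn !sqrtCK; apply: cauchy_schwarz.
Qed.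

Lemma ler_sqrt_formD x y : D x -> D y -> N (x + y) <= N x + N y.
Proof.
move=> Dx Dy; have Dxy := subspaceD D_sub Dx Dy.
rewrite -(@ler_pXn2r _ 2)// ?nnegrE ?addr_ge0 ?sqrtC_ge0 ?s_ge0//.
rewrite sqrrD !sqrtCK sesquiDl// !sesquiDr// -(sesqui_conj Dx Dy).
rewrite [leLHS](_ : _ = s x x + s y y + (s x y + (s x y)^*)); last by ring.
rewrite [leRHS](_ : _ = s x x + s y y + N x * N y *+ 2); last by ring.
rewrite lerD2l (le_trans (real_ler_norm _))//.
  by rewrite CrealE rmorphD/= conjCK addrC.
rewrite (le_trans (ler_normD _ _))// norm_conjC -mulr2n ler_pMn2r//.
exact: cauchy_schwarz_sqrt.
Qed.

Lemma sqrt_formZ a x : D x -> N (a *: x) = `|a| * N x.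
Proof.
move=> Dx; have Dax := subspaceZ D_sub a Dx.
rewrite sesquiZl// sesquiZr// mulrA -normCK rootCMl ?exprn_ge0//.
by rewrite sqrCK.
Qed.

End Sesqui.

(** * Sequences in normed modules over the complex numbers *)

Section Sequences.
Context (R : realType).

(** Positivity in the partial order of [R[i]] forces [e] to be real, so the Archimedean property of
    [R] applies. *)
Lemma invn_lt (e : R[i]) : 0 < e ->
  exists N, forall n, (N <= n)%N -> n.+1%:R^-1 < e.
Proof.
case: e => a b; rewrite ltcE/= => /andP[/eqP-> a_gt0].
exists (Num.truncn a^-1) => n Nn.
rewrite (_ : n.+1%:R^-1 = ((n.+1%:R^-1 : R)%:C)%C); last by rewrite fmorphV rmorph_nat.
rewrite ltcE/= eqxx/= invf_plt ?posrE// (lt_le_trans (truncnS_gt _))//.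
by rewrite ler_nat ltnS.
Qed.

Lemma norm_cvg_le (V : normedModType R[i]) (u : nat -> V) (v : V) (b : nat -> R[i]^o) :
  (forall n, `|u n - v| <= b n) -> b @ \oo --> (0 : R[i]^o) -> u @ \oo --> v.
Proof.
move=> ub b0; apply/cvgrPdist_lt => e e0.
move/cvgrPdist_lt : b0 => /(_ e e0); apply: filterS => n.
rewrite sub0r normrN distrC; apply: le_lt_trans.
by rewrite (le_trans (ub n))// real_ler_norm// ger0_real// (le_trans _ (ub n)).
Qed.

Lemma cvg_norm_close (V : normedModType R[i]) (u v : nat -> V) (x : V)
    (b : nat -> R[i]^o) :
  (forall n, `|u n - v n| <= b n) -> b @ \oo --> (0 : R[i]^o) ->
  v @ \oo --> x -> u @ \oo --> x.
Proof.
move=> ub b0 vx; have -> : u = (u \- v) \+ v by apply/funext => n /=; rewrite subrK.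
rewrite -[x]add0r; apply: cvgD => //.
by apply: norm_cvg_le b0 => n; rewrite subr0; apply: ub.
Qed.

Lemma cvg_unique_complex (u : nat -> R[i]) (a b : R[i]) :
  (u n : R[i]^o) @[n --> \oo] --> (a : R[i]^o) ->
  (u n : R[i]^o) @[n --> \oo] --> (b : R[i]^o) -> a = b.
Proof. exact: cvg_unique. Qed.

(** A complex number is nonnegative when it equals its modulus. Eventually [u n] is its own modulus,
    so [u] converges to the modulus of [a] as well as to [a]. *)
Lemma cvg_complex_ge0 (u : nat -> R[i]) (a : R[i]) : (\forall n \near \oo, 0 <= u n) ->
  (u n : R[i]^o) @[n --> \oo] --> (a : R[i]^o) -> 0 <= a.
Proof.
move=> u_ge0 ua; suff -> : a = `|a| by [].
apply: (cvg_unique_complex ua); apply/cvgrPdist_lt => e e0.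
move/cvgrPdist_lt : ua => /(_ e e0); apply: filterS2 u_ge0 => n un_ge0.
apply: le_lt_trans; rewrite -{1}(ger0_norm un_ge0).
exact: ler_dist_dist.
Qed.

Lemma cvg_invn : (n.+1%:R^-1 : R[i]^o) @[n --> \oo] --> (0 : R[i]^o).
Proof.
apply/cvgrPdist_lt => e /invn_lt[N Ne]; exists N => // n /= /Ne.
by rewrite sub0r normrN ger0_norm// invr_ge0.
Qed.

Lemma cvg_sqrtC0 (u : nat -> R[i]) : (forall n, 0 <= u n) ->
  (u n : R[i]^o) @[n --> \oo] --> (0 : R[i]^o) ->
  (sqrtC (u n) : R[i]^o) @[n --> \oo] --> (0 : R[i]^o).
Proof.
move=> u_ge0 /cvgrPdist_lt u0; apply/cvgrPdist_lt => e e0.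
have := u0 (e ^+ 2) (exprn_gt0 2 e0); apply: filterS => n.
rewrite !sub0r !normrN ger0_norm// ger0_norm ?sqrtC_ge0//.
by rewrite -{1}[u n]sqrtCK ltr_pXn2r// nnegrE ?sqrtC_ge0// ltW.
Qed.

Definition cauchy_seq (V : normedModType R[i]) (f : nat -> V) : Prop :=
  forall e : R[i], 0 < e -> exists N, forall n m,
    (N <= n)%N -> (N <= m)%N -> `|f n - f m| < e.

Lemma cauchy_seq_cvg (V : completeNormedModType R[i]) (f : nat -> V) :
  cauchy_seq f -> exists x : V, f @ \oo --> x.
Proof.
move=> f_cauchy; apply/cvg_ex/cauchy_cvgP/cauchy_ballP => e e0; near_simpl.
have [N fN] := f_cauchy e e0.
exists ([set n | (N <= n)%N], [set n | (N <= n)%N]) => /=.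
  by split; exists N.
by move=> [n m] /= [Nn Nm]; rewrite -ball_normE/=; apply: fN.
Qed.

Lemma cvg_cauchy_seq (V : normedModType R[i]) (f : nat -> V) (x : V) :
  f @ \oo --> x -> cauchy_seq f.
Proof.
move=> /cvgrPdist_lt fx e e0; have e20 : 0 < e / 2 by rewrite divr_gt0.
have [N _ fN] := fx _ e20.
exists N => n m Nn Nm; rewrite (splitr e) -(subrKA x).
by rewrite (le_lt_trans (ler_normD _ _))// ltrD// ?[`|f n - _|]distrC; apply: fN.
Qed.

Lemma cauchy_seq_le (V : normedModType R[i]) (f : nat -> V) (b : nat -> R[i]^o) :
  (forall n m, `|f n - f m| <= b n + b m) -> b @ \oo --> (0 : R[i]^o) ->
  cauchy_seq f.
Proof.
move=> fb /cvgrPdist_lt b0 e e0; have e20 : 0 < e / 2 by rewrite divr_gt0.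
have [N _ bN] := b0 _ e20.
exists N => n m Nn Nm; have := fb n m.
have b_real : b n + b m \is Num.real by rewrite ger0_real// (le_trans _ (fb n m)).
move/le_lt_trans; apply; rewrite (le_lt_trans (real_ler_norm b_real))//.
rewrite (splitr e) (le_lt_trans (ler_normD _ _))// ltrD//.
  by have := bN n Nn; rewrite sub0r normrN.
by have := bN m Nm; rewrite sub0r normrN.
Qed.

Lemma cauchy_seq_norm2 (V : normedModType R[i]) (f : nat -> V) (e : R[i]) :
  cauchy_seq f -> 0 < e -> exists N, forall n m,
    (N <= n)%N -> (N <= m)%N -> `|f n - f m| ^+ 2 < e.
Proof.
move=> f_cauchy e0; have [|N fN] := f_cauchy (sqrtC e); first by rewrite sqrtC_gt0.
exists N => n m Nn Nm; rewrite -[ltRHS]sqrtCK ltr_pXn2r// ?nnegrE ?sqrtC_ge0 ?(ltW e0)//.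
exact: fN.
Qed.

(** A Cauchy filter contains balls of radius [n.+1%:R^-1]. Any two of them meet, so their centers
    form a Cauchy sequence, and the filter converges to its limit. *)
Lemma seq_complete (V : normedModType R[i]) :
  (forall f : nat -> V, cauchy_seq f -> exists x : V, f @ \oo --> x) ->
  forall F : set_system V, ProperFilter F -> cauchy F -> cvg F.
Proof.
move=> V_complete F FF /cauchyP F_cauchy.
have inv_gt0 n : 0 < n.+1%:R^-1 :> R[i] by rewrite invr_gt0.
pose f n := sval (cid (F_cauchy _ (inv_gt0 n))).
have Ff n : F (ball (f n) n.+1%:R^-1) := svalP (cid (F_cauchy _ (inv_gt0 n))).
have [|x fx] := V_complete f.
  apply: cauchy_seq_le cvg_invn => n m.
  have [y []] := filter_ex (filterI (Ff n) (Ff m)).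
  rewrite -!ball_normE/= => fny fmy; rewrite -(subrKA y).
  by rewrite (le_trans (ler_normD _ _))// lerD// ltW// distrC.
apply/cvg_ex; exists x; apply/cvgrPdist_lt => e e0.
have e20 : 0 < e / 2 by rewrite divr_gt0.
have [N1 N1e] := invn_lt e20.
move/cvgrPdist_lt : fx => /(_ _ e20)[N2 _ N2e].
pose n := maxn N1 N2; have := Ff n; apply: filterS => y.
rewrite -ball_normE/= => fny; rewrite (splitr e) -(subrKA (f n)).
rewrite (le_lt_trans (ler_normD _ _))// ltrD//.
  exact/N2e/leq_maxr.
by rewrite (lt_trans fny)// N1e// leq_maxl.
Qed.

Lemma norm_complex_le (z : R[i]) : `|z| <= (`|complex.Re z| + `|complex.Im z|)%:C%C.
Proof.
have norm_i : `|('i%C : R[i])| = 1.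
  by rewrite normc_def/= expr0n/= add0r expr1n sqrtr1.
rewrite [in leLHS](complexE z) (le_trans (ler_normD _ _))// normrM norm_i mul1r.
by rewrite !normc_def/= expr0n/= !addr0 !sqrtr_sqr -rmorphD/=.
Qed.

Lemma complex_cauchy_cvg (u : nat -> R[i]^o) :
  cauchy_seq u -> exists z : R[i]^o, u @ \oo --> z.
Proof.
move=> u_cauchy.
(* [p] stands for the real or the imaginary part; both are additive and bounded by the modulus, so
   completeness of [R] gives their limits. *)
have part_cvg (p : R[i] -> R) :
    (forall z w, p (z - w) = p z - p w) -> (forall z, `|p z|%:C%C <= `|z|) ->
    exists a : R, p \o u @ \oo --> a.
  move=> pB p_le; apply/cvg_ex/cauchy_cvgP/cauchy_ballP => e e0; near_simpl.
  have [|N uN] := u_cauchy (e%:C)%C; first by rewrite ltcR.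
  exists ([set n | (N <= n)%N], [set n | (N <= n)%N]) => /=.
    by split; exists N.
  move=> [n m] /= [Nn Nm]; rewrite -ball_normE/= -pB -ltcR.
  exact: le_lt_trans (p_le _) (uN _ _ Nn Nm).
have [a ua] : exists a : R, @complex.Re R \o u @ \oo --> a.
  by apply: part_cvg => [[? ?] [? ?]|z] //; apply: normc_ge_Re.
have [b ub] : exists b : R, @complex.Im R \o u @ \oo --> b.
  apply: part_cvg => [[? ?] [? ?]|[x y]] //.
  rewrite normc_def lecR/= -sqrtr_sqr ler_wsqrtr// lerDr sqr_ge0//.
exists (a +i* b)%C; apply/cvgrPdist_lt => -[e e'].
rewrite ltcE/= => /andP[/eqP->{e'} e0].
have e20 : 0 < e / 2 by rewrite divr_gt0.
move/cvgrPdist_lt : ua => /(_ _ e20)[N1 _ N1e].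
move/cvgrPdist_lt : ub => /(_ _ e20)[N2 _ N2e].
exists (maxn N1 N2) => // n /=; rewrite geq_max => /andP[/N1e/= h1 /N2e/= h2].
apply: (le_lt_trans (norm_complex_le _)).
case: (u n) h1 h2 => x y /= h1 h2; rewrite ltcR (splitr e) ltrD//.
Qed.

(** Replaces the product filter in [form_cvg] by one index bound common to both variables. *)
Lemma cvg_pairP (u : nat * nat -> R[i]) :
  ((u p : R[i]^o) @[p --> (\oo, \oo)] --> (0 : R[i]^o)) <->
  forall e : R[i], 0 < e -> exists N, forall n m,
    (N <= n)%N -> (N <= m)%N -> `|u (n, m)| < e.
Proof.
split=> [/cvgrPdist_lt u0 e /u0 [[A B] /= [[N1 _ AN] [N2 _ BN]] ABe]|ue].
  exists (maxn N1 N2) => n m; rewrite !geq_max => /andP[n1 n2] /andP[m1 m2].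
  have := ABe (n, m); rewrite /= sub0r normrN; apply.
  by split; [apply: AN|apply: BN].
apply/cvgrPdist_lt => e /ue[N Ne].
exists ([set n | (N <= n)%N], [set n | (N <= n)%N]) => /=.
  by split; exists N.
by move=> [n m] /= [Nn Nm]; rewrite sub0r normrN; apply: Ne.
Qed.

(** Makes the closure in [biadjoint] sequential: the point [f n] is taken within [n.+1%:R^-1] of the
    limit in each coordinate. *)
Lemma closure_prodP (V W : normedModType R[i]) (A : set (V * W)) x y :
  closure A (x, y) <-> exists f : nat -> V * W,
    [/\ forall n, A (f n), (f n).1 @[n --> \oo] --> x &
        (f n).2 @[n --> \oo] --> y].
Proof.
split=> [clA|[f [fA fx fy]] U [[P Q] /= [Px Qy] PQU]]; last first.
  have [n [Pn Qn]] : exists n, P (f n).1 /\ Q (f n).2.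
    by apply: (@filter_ex _ \oo); apply: filterI; [exact: fx|exact: fy].
  by exists (f n); split; [exact: fA|apply: PQU].
have inv_gt0 n : 0 < n.+1%:R^-1 :> R[i] by rewrite invr_gt0.
have ex n : exists p, A p /\ (`|p.1 - x| <= n.+1%:R^-1 /\ `|p.2 - y| <= n.+1%:R^-1).
  have [|p [Ap [/= px py]]] := clA [set p | ball x n.+1%:R^-1 p.1 /\ ball y n.+1%:R^-1 p.2].
    exists (ball x n.+1%:R^-1, ball y n.+1%:R^-1) => //=.
    by split; apply: nbhsx_ballx.
  exists p; split=> //; move: px py; rewrite -!ball_normE/= => px py.
  by split; rewrite distrC ltW.
pose f n := sval (cid (ex n)).
have fP n := svalP (cid (ex n)).
exists f; split=> [n||]; first by have [] := fP n.
  by apply: norm_cvg_le cvg_invn => n; have [_ []] := fP n.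
by apply: norm_cvg_le cvg_invn => n; have [_ []] := fP n.
Qed.

(** Continuity of a semidefinite form in its own seminorm: the difference of the values splits into
    [s (f n - x) (g n - y)], [s (f n - x) y] and [s x (g n - y)], each controlled by
    Cauchy-Schwarz. *)
Lemma cvg_sesqui (V : lmodType R[i]) (D : set V) (s : V -> V -> R[i])
    (f g : nat -> V) (x y : V) :
  sesqui_on D s -> (forall z, D z -> 0 <= s z z) ->
  (forall n, D (f n)) -> (forall n, D (g n)) -> D x -> D y ->
  (s (f n - x) (f n - x) : R[i]^o) @[n --> \oo] --> (0 : R[i]^o) ->
  (s (g n - y) (g n - y) : R[i]^o) @[n --> \oo] --> (0 : R[i]^o) ->
  (s (f n) (g n) : R[i]^o) @[n --> \oo] --> (s x y : R[i]^o).
Proof.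
move=> s_sesqui s_ge0 Df Dg Dx Dy.
have [D_sub _ _] := s_sesqui.
have Dfx n : D (f n - x) by apply: subspaceB.
have Dgy n : D (g n - y) by apply: subspaceB.
move=> /cvg_sqrtC0-/(_ (fun n => s_ge0 _ (Dfx n))) fx.
move=> /cvg_sqrtC0-/(_ (fun n => s_ge0 _ (Dgy n))) gy.
set F := fun n => sqrtC _ in fx; set G := fun n => sqrtC _ in gy.
apply: (@norm_cvg_le _ _ _ (fun n =>
  F n * G n + F n * sqrtC (s y y) + sqrtC (s x x) * G n)) => [n|].
  have -> : s (f n) (g n) - s x y =
      s (f n - x) (g n - y) + s (f n - x) y + s x (g n - y).
    rewrite !(sesquiBr s_sesqui)// !(sesquiBl s_sesqui)//; ring.
  rewrite (le_trans (ler_normD _ _))// lerD//; last exact: cauchy_schwarz_sqrt s_ge0 _ _ _ _.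
  by rewrite (le_trans (ler_normD _ _))// lerD//; apply: cauchy_schwarz_sqrt s_ge0 _ _ _ _.
rewrite [X in _ --> X](_ : _ = 0 * 0 + 0 * sqrtC (s y y) + sqrtC (s x x) * 0);
  last by ring.
apply: cvgD; [apply: cvgD; [exact: cvgM|exact: (cvgM fx (@cvg_cst _ _ _ _ _))]|].
exact: (cvgM (@cvg_cst _ _ _ _ _) gy).
Qed.

End Sequences.

(** * Orthogonal projections *)

Section Projection.
Context (R : realType) (K : hilbertType R).
Implicit Types (x y z p : K) (M : set K).

Lemma inner_sesqui : sesqui_on setT (@inner R K).
Proof. by split=> // *; rewrite (linearPl, linearPr). Qed.

Lemma inner_ge0 x : 0 <= inner x x.
Proof. by rewrite -normr_inner exprn_ge0. Qed.

Lemma inner_conj x y : (inner x y)^*%R = inner y x.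
Proof. exact: sesqui_conj inner_sesqui (fun x _ => inner_ge0 x) _ _ I I. Qed.

Lemma cvg_norm2 (f : nat -> K) : f @ \oo --> (0 : K) ->
  (`|f n| ^+ 2 : R[i]^o) @[n --> \oo] --> (0 : R[i]^o).
Proof.
move=> /cvg_norm; rewrite normr0 => f0.
have -> : (0 : R[i]^o) = 0 * 0 by rewrite mulr0.
exact: (cvgM f0 f0).
Qed.

Lemma cvg_inner (f g : nat -> K) x y : f @ \oo --> x -> g @ \oo --> y ->
  (inner (f n) (g n) : R[i]^o) @[n --> \oo] --> (inner x y : R[i]^o).
Proof.
move=> fx gy.
have dist0 (h : nat -> K) z : h @ \oo --> z ->
    (inner (h n - z) (h n - z) : R[i]^o) @[n --> \oo] --> (0 : R[i]^o).
  move=> hz.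
  have -> : (fun n => inner (h n - z) (h n - z)) = (fun n => `|h n - z| ^+ 2).
    by apply/funext => n; rewrite normr_inner.
  apply: (@cvg_norm2 (fun n => h n - z)).
  rewrite -(subrr z); exact: (cvgB hz (@cvg_cst _ _ _ _ _)).
by apply: (cvg_sesqui inner_sesqui (fun x _ => inner_ge0 x)) => //; apply: dist0.
Qed.

Lemma pythagoras x y : inner x y = 0 -> `|x + y| ^+ 2 = `|x| ^+ 2 + `|y| ^+ 2.
Proof.
move=> xy0; rewrite !normr_inner linearDl/= !linearDr/= -(inner_conj x y) xy0.
by rewrite rmorph0 addr0 add0r.
Qed.

Lemma parallelogram x y :
  `|x + y| ^+ 2 + `|x - y| ^+ 2 = 2 * `|x| ^+ 2 + 2 * `|y| ^+ 2.
Proof.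
rewrite !normr_inner !linearDl/= !linearNl/= !linearDr/= !linearNr/=; ring.
Qed.

Definition seq_closed M : Prop :=
  forall (f : nat -> K) x, (forall n, M (f n)) -> f @ \oo --> x -> M x.

(** Replacing [p] by [p + a *: y], with [a *: y] the component of [x - p] along [y], lowers the
    squared distance by the squared modulus of [inner (x - p) y] divided by [inner y y]; minimality
    makes this zero. *)
Lemma minimal_dist_orthogonal M x p : Defs.subspace M -> M p ->
  (forall y, M y -> `|x - p| ^+ 2 <= `|x - y| ^+ 2) ->
  forall y, M y -> inner (x - p) y = 0.
Proof.
move=> M_sub Mp x_min y My; set z := x - p.
have [->|y0] := eqVneq y 0; first by rewrite linear0r.
have yy0 : 0 < inner y y by rewrite -normr_inner exprn_gt0// normr_gt0.
pose a := inner z y / inner y y.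
have := x_min _ (subspaceD M_sub Mp (subspaceZ M_sub a My)).
rewrite opprD addrA -/z !normr_inner.
rewrite (sesqui_sqrB inner_sesqui (fun x _ => inner_ge0 x))// -subr_ge0.
have conj_yy : (inner y y)^*%R = inner y y by rewrite inner_conj.
rewrite (_ : _ - _ = - (`|inner z y| ^+ 2 / inner y y)); last first.
  rewrite /a rmorphM fmorphV/= conj_yy normCK; field; exact: lt0r_neq0.
rewrite oppr_ge0 => le0; apply/eqP; rewrite -normr_eq0 -sqrf_eq0 -/z.
have : 0 <= `|inner z y| ^+ 2 / inner y y by rewrite divr_ge0 ?exprn_ge0 ?inner_ge0.
move=> ge0; have /eqP : `|inner z y| ^+ 2 / inner y y = 0 by apply/le_anti/andP.
by rewrite mulf_eq0 invr_eq0 (gt_eqF yy0) orbF.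
Qed.

(** A minimizing sequence for the distance from [x] to [M] is Cauchy by the parallelogram law, and
    its limit is a nearest point. The infimum is taken in [R], hence the real-valued squared
    distance [q]. *)
Lemma exists_orthoproj M x : Defs.subspace M -> seq_closed M ->
  exists p, M p /\ forall y, M y -> inner (x - p) y = 0.
Proof.
move=> M_sub M_closed; pose q y : R := complex.Re (`|x - y| ^+ 2).
have qE y : (q y)%:C%C = `|x - y| ^+ 2 by rewrite RRe_real// ger0_real// exprn_ge0.
pose S := [set q y | y in M]; pose d := inf S.
have q_ge0 y : 0 <= q y by rewrite -ler0c qE exprn_ge0.
have S_inf : has_inf S.
  split; first by exists (q 0), 0 => //; apply: subspace0.
  by exists 0 => _ [y _ <-].
have d_le y : M y -> d <= q y.
  by move=> My; apply: ge_inf; [case: S_inf|exists y].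
have ex n : exists y, M y /\ q y < d + n.+1%:R^-1.
  have [_ [y My <-] qy] := @inf_adherent _ S n.+1%:R^-1 ltac:(by rewrite invr_gt0) S_inf.
  by exists y.
have [y yP] := choice ex; have My n := (yP n).1; have qy n := (yP n).2.
have y_close n m : `|y n - y m| ^+ 2 <= 2 * n.+1%:R^-1 + 2 * m.+1%:R^-1 :> R[i].
  (* The midpoint lies in [M], so [d <= q w]; in the parallelogram law only the excesses of
     [q (y n)] and [q (y m)] over [d] survive. *)
  pose w := 2^-1 *: (y n + y m).
  have Mw : M w by apply/(subspaceZ M_sub)/(subspaceD M_sub).
  have := parallelogram (x - y n) (x - y m).
  rewrite (_ : x - y n + (x - y m) = (2 : R[i]) *: (x - w)); last first.
    rewrite scalerBr scalerA divff ?pnatr_eq0// scale1r scaler_nat mulr2n opprD.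
    by rewrite addrACA.
  rewrite (_ : x - y n - (x - y m) = y m - y n); last first.
    by rewrite opprB addrC addrA subrK.
  rewrite normrZ exprMn ger0_norm// -!qE distrC => e.
  rewrite (_ : `|_| ^+ 2 = (2 * q (y n) + 2 * q (y m) - 2 ^+ 2 * q w)%:C%C); last first.
    rewrite rmorphB rmorphD !rmorphM/= !rmorph_nat. rewrite -expr2 -e.
    by rewrite addrAC subrr add0r.
  rewrite (_ : _ + _ = (2 * n.+1%:R^-1 + 2 * m.+1%:R^-1)%:C%C); last first.
    by rewrite rmorphD !rmorphM/= !fmorphV/= !rmorph_nat.
  rewrite lecR; have := d_le _ Mw; have := qy n; have := qy m.
  by move: (q (y m)) (q (y n)) (q w) (n.+1%:R^-1) (m.+1%:R^-1) => *; lra.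
have [|p yp] := @cauchy_seq_cvg _ K y.
  move=> e e0; have e40 : 0 < e ^+ 2 / 4 by rewrite divr_gt0// exprn_gt0.
  have [N iN] := invn_lt e40; exists N => n m /iN ni /iN mi.
  rewrite -(@ltr_pXn2r _ 2)// ?nnegrE ?(ltW e0)// (le_lt_trans (y_close n m))//.
  rewrite (_ : e ^+ 2 = 2 * (e ^+ 2 / 4) + 2 * (e ^+ 2 / 4)); last by field.
  by rewrite ltrD// ltr_pM2l.
have Mp : M p by apply: M_closed yp.
exists p; split=> //; apply: minimal_dist_orthogonal => // z /d_le.
rewrite -lecR qE; apply: le_trans; rewrite -subr_ge0.
have lim_dist : ((d + n.+1%:R^-1)%:C%C - `|x - y n| ^+ 2 : R[i]^o) @[n --> \oo]
    --> (d%:C%C - `|x - p| ^+ 2 : R[i]^o).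
  have -> : (fun n => (d + n.+1%:R^-1)%:C%C - `|x - y n| ^+ 2) =
      (fun n => (d%:C%C + n.+1%:R^-1) - inner (x - y n) (x - y n)).
    by apply/funext => n; rewrite rmorphD/= fmorphV/= rmorph_nat normr_inner.
  have xy : (x - y n) @[n --> \oo] --> x - p by exact: (cvgB (@cvg_cst _ _ _ _ _) yp).
  rewrite normr_inner -[d%:C%C in X in _ --> X]addr0.
  exact: (cvgB (cvgD (@cvg_cst _ _ _ _ _) (@cvg_invn R)) (cvg_inner xy xy)).
apply: cvg_complex_ge0 lim_dist; apply: nearW => n.
by rewrite -qE subr_ge0 lecR ltW.
Qed.

(** * Linearity and continuity of the projection onto a closed subspace *)

Section Orthoproj.
Context (M : set K) (M_sub : Defs.subspace M) (M_closed : seq_closed M).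
Local Notation P := (orthoproj M).

Lemma orthoprojP x : M (P x) /\ forall y, M y -> inner (x - P x) y = 0.
Proof. exact: (xgetPex 0 (exists_orthoproj x M_sub M_closed)). Qed.

(** [P x - p] lies in [M], and it is orthogonal to [M] as the difference of [x - p] and
    [x - P x]. *)
Lemma orthoproj_uniq x p : M p -> (forall y, M y -> inner (x - p) y = 0) -> P x = p.
Proof.
move=> Mp xp; have [MPx xPx] := orthoprojP x.
have Md : M (P x - p) by apply: (subspaceB M_sub).
apply/eqP; rewrite -subr_eq0 -normr_eq0 -sqrf_eq0 normr_inner.
rewrite {1}(_ : P x - p = (x - p) - (x - P x)); last by rewrite opprB [RHS]addrC subrKA.
by rewrite linearBl/= xp// xPx// subr0.
Qed.

Lemma orthoproj_linear a x y : P (a *: x + y) = a *: P x + P y.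
Proof.
have [[MPx xPx] [MPy yPy]] := (orthoprojP x, orthoprojP y).
apply: orthoproj_uniq => [|z Mz]; first exact: (subspaceD M_sub (subspaceZ M_sub _ _)).
rewrite opprD addrACA -scalerBr linearPl/= xPx// yPy//.
by rewrite mulr0 addr0.
Qed.

Lemma orthoprojB x y : P (x - y) = P x - P y.
Proof. by rewrite addrC -scaleN1r orthoproj_linear scaleN1r addrC. Qed.

Lemma orthoproj_id x : M x -> P x = x.
Proof. by move=> Mx; apply: orthoproj_uniq => // y My; rewrite subrr linear0l. Qed.

Lemma orthoproj_orthogonal x : (forall y, M y -> inner x y = 0) -> P x = 0.
Proof.
by move=> xM; apply: orthoproj_uniq => [|y My]; [exact: subspace0|rewrite subr0 xM].
Qed.

Lemma orthoproj_pythagoras x : `|x| ^+ 2 = `|x - P x| ^+ 2 + `|P x| ^+ 2.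
Proof.
by have [MPx xPx] := orthoprojP x; rewrite -pythagoras ?subrK// xPx.
Qed.

Lemma orthoproj_norm x : `|P x| <= `|x|.
Proof.
rewrite -(@ler_pXn2r _ 2)// ?nnegrE// (orthoproj_pythagoras x).
by rewrite lerDr exprn_ge0.
Qed.

Lemma cvg_orthoproj (f : nat -> K) x : f @ \oo --> x -> (P \o f) @ \oo --> P x.
Proof.
move=> fx; apply: (norm_cvg_le (b := fun n => `|f n - x|)) => [n|].
  by rewrite -orthoprojB orthoproj_norm.
rewrite -(normr0 K) -(subrr x).
exact: (cvg_norm (cvgB fx (@cvg_cst _ _ _ _ _))).
Qed.

End Orthoproj.
End Projection.

(** * Completion of a semi-inner product space *)

(** Bundles the form with its properties, so that the type [completion s] can carry Hilbert space
    structure without further hypotheses. *)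
Record semi_inner (R : realType) (V : lmodType R[i]) := SemiInner {
  sidom : set V ;
  siform :> V -> V -> R[i] ;
  si_sesqui : sesqui_on sidom siform ;
  si_ge0 : forall x, sidom x -> 0 <= siform x x
}.

Section Completion.
Context (R : realType) (V : lmodType R[i]) (s : semi_inner V).

Notation D := (sidom s).
Local Notation N x := (sqrtC (s x x)).
Let D_sub : Defs.subspace D. Proof. by case: (si_sesqui s). Qed.
Let sN_ge0 x : D x -> 0 <= N x. Proof. by move=> /si_ge0; rewrite sqrtC_ge0. Qed.

Implicit Types (f g : V -> R[i]) (x y : V) (e : R[i]).

(* A point of the completion is the functional [y |-> s x y], extended by 0
   outside [D], or a limit of such functionals in the norm dual to
   [sqrtC (s y y)]; this makes the completion a submodule of [V -> R[i]] and
   needs no quotient. *)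
Definition approx f x e : Prop :=
  D x /\ forall y, D y -> `|f y - s x y| <= e * N y.

(** Testing both approximations at the vector [x - y] itself bounds the square of [N (x - y)] by
    [(e1 + e2) * N (x - y)]. *)
Lemma approx_dist f x y e1 e2 : 0 <= e1 -> 0 <= e2 ->
  approx f x e1 -> approx f y e2 -> N (x - y) <= e1 + e2.
Proof.
move=> e1_ge0 e2_ge0 [Dx fx] [Dy fy].
have Dxy : D (x - y) by apply: subspaceB.
have [->|Nxy0] := eqVneq (N (x - y)) 0; first by rewrite addr_ge0.
rewrite -(@ler_pM2r _ (N (x - y))) ?lt_def ?Nxy0 ?sN_ge0//.
rewrite -expr2 sqrtCK -[leLHS]ger0_norm ?si_ge0//.
rewrite {1}(sesquiBl (si_sesqui s))// -(subrKA (f (x - y))).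
by rewrite (le_trans (ler_normD _ _))// mulrDl lerD// distrC ?fx// distrC fy.
Qed.

Lemma approxW f x e1 e2 : e1 <= e2 -> approx f x e1 -> approx f x e2.
Proof.
move=> e12 [Dx fx]; split=> // y Dy.
by rewrite (le_trans (fx y Dy))// ler_wpM2r// sN_ge0.
Qed.

Lemma approx_linear f g a x y e1 e2 : approx f x e1 -> approx g y e2 ->
  approx (a *: f + g) (a *: x + y) (`|a| * e1 + e2).
Proof.
move=> [Dx fx] [Dy gy]; split=> [|z Dz].
  exact: subspaceD (subspaceZ _ _ _) _.
case: (si_sesqui s) => _ -> // _; rewrite [_ z](_ : _ = a * f z + g z)//.
rewrite (_ : _ - _ = a * (f z - s x z) + (g z - s y z)); last by ring.
rewrite (le_trans (ler_normD _ _))// mulrDl lerD ?gy// normrM -mulrA.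
by rewrite ler_wpM2l// fx.
Qed.

(** Serves twice: it shows that the values of [s] on approximants are Cauchy, and that their limit
    is independent of the approximants. *)
Lemma approx_form_dist f g x x' y y' e1 e1' e2 e2' :
  0 <= e1 -> 0 <= e1' -> 0 <= e2 -> 0 <= e2' ->
  approx f x e1 -> approx f x' e1' -> approx g y e2 -> approx g y' e2' ->
  `|s x y - s x' y'| <= (e1 + e1') * N y + N x' * (e2 + e2').
Proof.
move=> ? ? ? ? fx fx' gy gy'.
have [[[[Dx _] [Dx' _]] [Dy _]] [Dy' _]] := (fx, fx', gy, gy').
have Dxx : D (x - x') by apply: subspaceB.
have Dyy : D (y - y') by apply: subspaceB.
have -> : s x y - s x' y' = s (x - x') y + s x' (y - y').
  by rewrite (sesquiBl (si_sesqui s))// (sesquiBr (si_sesqui s))// addrA subrK.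
have cs := cauchy_schwarz_sqrt (si_sesqui s) (@si_ge0 _ _ s).
rewrite (le_trans (ler_normD _ _))// lerD// (le_trans (cs _ _ _ _))//.
  by rewrite ler_wpM2r ?sN_ge0//; apply: approx_dist fx fx'.
by rewrite ler_wpM2l ?sN_ge0//; apply: approx_dist gy gy'.
Qed.

(** Prescribing the value 0 outside [D] makes a point of the completion determined by its values on
    [D]. *)
Definition completable : {pred V -> R[i]} := fun f =>
  `[< (forall y, ~ D y -> f y = 0) /\ forall e, 0 < e -> exists x, approx f x e >].

Lemma completable_submod : submod_closed completable.
Proof.
split=> [|a f g /asboolP[f0 fx] /asboolP[g0 gx]]; apply/asboolP; split=> //.
- move=> e e0; exists 0; split=> [|y Dy]; first exact: subspace0.
  have -> : s 0 y = 0.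
    rewrite -(scale0r (0 : V)) (sesquiZl (si_sesqui s)) ?mul0r//.
    exact: subspace0.
  rewrite subr0 normr0.
  by rewrite mulr_ge0 ?sN_ge0// ltW.
- by move=> y Dy; rewrite [LHS](_ : _ = a * f y + g y)// f0// g0// mulr0 addr0.
move=> e e0; have e20 : 0 < e / 2 by rewrite divr_gt0.
have a_gt0 : 0 < `|a| + 1 by rewrite ltr_wpDl.
(* The summand 1 keeps the divisor positive when [a = 0]. *)
have [x fxe] := fx (e / 2 / (`|a| + 1)) (divr_gt0 e20 a_gt0).
have [y gye] := gx _ e20.
exists (a *: x + y); apply: approxW (approx_linear a fxe gye).
rewrite [leRHS]splitr lerD2r mulrA ler_pdivrMr// mulrC ler_wpM2l// ?lerDl//.
exact: ltW.
Qed.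

HB.instance Definition _ := GRing.isSubmodClosed.Build _ _ completable
  completable_submod.

Record completion := Completion {
  cval :> V -> R[i] ;
  cvalP : cval \in completable
}.

HB.instance Definition _ := [isSub for cval].
HB.instance Definition _ := [Choice of completion by <:].
HB.instance Definition _ := [SubChoice_isSubLmodule of completion by <:].

End Completion.

(** * The inner product of the completion as a limit along approximants *)

Section CompletionInner.
Context (R : realType) (V : lmodType R[i]) (s : semi_inner V).

Notation D := (sidom s).
Local Notation N x := (sqrtC (s x x)).
Let D_sub : Defs.subspace D. Proof. by case: (si_sesqui s). Qed.
Let sN_ge0 x : D x -> 0 <= N x. Proof. by move=> /si_ge0; rewrite sqrtC_ge0. Qed.

Implicit Types (F G : completion s) (x y : V) (e : nat -> R[i]^o).

Let inv_gt0 n : 0 < n.+1%:R^-1 :> R[i]. Proof. by rewrite invr_gt0. Qed.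
Let inv_ge0 n : 0 <= n.+1%:R^-1 :> R[i]. Proof. by rewrite invr_ge0. Qed.

Lemma exists_approx F n : exists x, approx s F x n.+1%:R^-1.
Proof. by have /asboolP[_ /(_ _ (inv_gt0 n))] := cvalP F. Qed.

Definition rep F n : V := sval (cid (exists_approx F n)).

Lemma repP F n : approx s F (rep F n) n.+1%:R^-1.
Proof. exact: svalP (cid (exists_approx F n)). Qed.

Lemma sqrt_form_le x y : D x -> D y -> N y <= N (y - x) + N x.
Proof.
move=> Dx Dy; rewrite -[in leLHS](subrK x y).
by apply: ler_sqrt_formD (si_sesqui s) (@si_ge0 _ _ s) _ _ _ _; rewrite //; apply: subspaceB.
Qed.

(** The errors of the two approximants add up to [n.+1%:R^-1 + 1 <= 2]. A bound uniform in [n] is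
    what makes the products in [approx_form_dist] tend to 0. *)
Lemma rep_bound F n : N (rep F n) <= 2 + N (rep F 0).
Proof.
have [Dn _] := repP F n; have [D0 _] := repP F 0.
rewrite (le_trans (sqrt_form_le D0 Dn))// lerD2r.
rewrite (le_trans (approx_dist _ _ (repP F n) (repP F 0)))//.
by rewrite invr1 lerD// invf_le1// ler1n.
Qed.

Lemma rep_form_cauchy F G : cauchy_seq (fun n => s (rep F n) (rep G n) : R[i]^o).
Proof.
pose B := (2 + N (rep G 0)) + (2 + N (rep F 0)).
apply: (@cauchy_seq_le _ _ _ (fun n => B * n.+1%:R^-1)) => [n m|]; last first.
  rewrite [X in _ --> X](_ : _ = B * 0); last by rewrite mulr0.
  exact: (cvgM (@cvg_cst _ _ _ _ _) (@cvg_invn R)).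
rewrite (le_trans (approx_form_dist _ _ _ _ (repP F n) (repP F m)
  (repP G n) (repP G m)))//.
rewrite -[leRHS]mulrDr [leRHS]mulrDl lerD//.
  by rewrite mulrC ler_wpM2r ?addr_ge0// rep_bound.
by rewrite ler_wpM2r ?addr_ge0// rep_bound.
Qed.

Definition cinner F G : R[i] :=
  sval (cid (complex_cauchy_cvg (@rep_form_cauchy F G))).

Lemma cvg_rep_cinner F G :
  (s (rep F n) (rep G n) : R[i]^o) @[n --> \oo] --> (cinner F G : R[i]^o).
Proof. exact: svalP (cid (complex_cauchy_cvg (@rep_form_cauchy F G))). Qed.

(** Any approximants with vanishing errors compute [cinner], not only the chosen [rep]. Linearity
    and the values on embedded vectors follow by taking convenient ones. *)
Lemma cvg_cinner F G (x y : nat -> V) e e' :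
  (forall n, 0 <= e n) -> (forall n, 0 <= e' n) ->
  (forall n, approx s F (x n) (e n)) -> (forall n, approx s G (y n) (e' n)) ->
  e @ \oo --> (0 : R[i]^o) -> e' @ \oo --> (0 : R[i]^o) ->
  (s (x n) (y n) : R[i]^o) @[n --> \oo] --> (cinner F G : R[i]^o).
Proof.
move=> e_ge0 e'_ge0 Fx Gy e0 e'0.
pose A n := (e n + n.+1%:R^-1); pose A' n := (e' n + n.+1%:R^-1).
have A0 : A @ \oo --> (0 : R[i]^o).
  rewrite -[0 in X in _ --> X]addr0; exact: (cvgD e0 (@cvg_invn R)).
have A'0 : A' @ \oo --> (0 : R[i]^o).
  rewrite -[0 in X in _ --> X]addr0; exact: (cvgD e'0 (@cvg_invn R)).
apply: (cvg_norm_close (b := fun n => A n * A' n +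
   (A n * (2 + N (rep G 0)) + (2 + N (rep F 0)) * A' n)) _ _
    (@cvg_rep_cinner F G)) => [n|]; last first.
  rewrite [X in _ --> X](_ : _ = 0 * 0 +
    (0 * (2 + N (rep G 0)) + (2 + N (rep F 0)) * 0)); last by ring.
  apply: cvgD; first exact: cvgM.
  apply: cvgD; first exact: (cvgM A0 (@cvg_cst _ _ _ _ _)).
  exact: (cvgM (@cvg_cst _ _ _ _ _) A'0).
rewrite (le_trans (approx_form_dist _ _ _ _ (Fx n) (repP F n)
  (Gy n) (repP G n)))//.
rewrite addrA lerD//; last first.
  by rewrite ler_wpM2r ?addr_ge0// rep_bound.
rewrite -mulrDr ler_wpM2l ?addr_ge0//.
have [[Dy _] [Dr _]] := (Gy n, repP G n).
rewrite (le_trans (sqrt_form_le Dr Dy))// lerD ?rep_bound//.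
exact: approx_dist (Gy n) (repP G n).
Qed.

End CompletionInner.

(** * Inner product axioms and the norm of the completion *)

Section CompletionHilbert.
Context (R : realType) (V : lmodType R[i]) (s : semi_inner V).

Notation D := (sidom s).
Local Notation N x := (sqrtC (s x x)).
Let D_sub : Defs.subspace D. Proof. by case: (si_sesqui s). Qed.
Let s_conj := sesqui_conj (si_sesqui s) (@si_ge0 _ _ s).
Let sN_ge0 x : D x -> 0 <= N x. Proof. by move=> /si_ge0; rewrite sqrtC_ge0. Qed.

Implicit Types (F G : completion s) (x y : V).

Let inv_ge0 n : 0 <= n.+1%:R^-1 :> R[i]. Proof. by rewrite invr_ge0. Qed.
Let inv0 := @cvg_invn R.

Lemma cinner_linear G a F F' :
  cinner (a *: F + F') G = a * cinner F G + cinner F' G.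
Proof.
apply: (@cvg_unique_complex _ (fun n => s (a *: rep F n + rep F' n) (rep G n))).
  apply: (cvg_cinner (e := fun n => `|a| * n.+1%:R^-1 + n.+1%:R^-1)
    (e' := fun n => n.+1%:R^-1)) => // [n|n|n|].
  - by rewrite addr_ge0// mulr_ge0.
  - exact: approx_linear (repP F n) (repP F' n).
  - exact: repP.
  - rewrite [X in _ --> X](_ : _ = `|a| * 0 + 0); last by rewrite mulr0 addr0.
    exact: (cvgD (cvgM (@cvg_cst _ _ _ _ _) inv0) inv0).
rewrite (_ : (fun n => _) = fun n => a * s (rep F n) (rep G n) + s (rep F' n) (rep G n)).
  exact: (cvgD (cvgM (@cvg_cst _ _ _ _ _) (@cvg_rep_cinner _ _ _ F G))
    (@cvg_rep_cinner _ _ _ F' G)).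
apply/funext => n; have [[DF _] [DF' _]] := (repP F n, repP F' n).
by have [DG _] := repP G n; case: (si_sesqui s) => _ ->.
Qed.

Lemma cinner_conj F G : cinner F G = (cinner G F)^*%R.
Proof.
apply: cvg_unique_complex (@cvg_rep_cinner _ _ _ F G) _.
apply/cvgrPdist_lt => e e0.
move/cvgrPdist_lt : (@cvg_rep_cinner _ _ _ G F) => /(_ e e0); apply: filterS => n.
have [[DF _] [DG _]] := (repP F n, repP G n).
by rewrite -[s (rep F n) _]s_conj// -rmorphB/= norm_conjC.
Qed.

Lemma cinner_linear_r G a F F' :
  cinner G (a *: F + F') = a^*%R * cinner G F + cinner G F'.
Proof.
by rewrite cinner_conj cinner_linear rmorphD rmorphM/= -!cinner_conj.
Qed.

Lemma cinner_ge0 F : 0 <= cinner F F.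
Proof.
apply: cvg_complex_ge0 (@cvg_rep_cinner _ _ _ F F); apply: nearW => n.
by have [DF _] := repP F n; apply: si_ge0.
Qed.

Lemma completionP F G : (forall x, D x -> F x = G x) -> F = G.
Proof.
move=> FG; apply/val_inj/funext => x /=.
have [Dx|nDx] := pselect (D x); first exact: FG.
have /asboolP[F0 _] := cvalP F; have /asboolP[G0 _] := cvalP G.
by rewrite F0// G0.
Qed.

(** Definiteness holds even if [s] is degenerate: the approximants tend to 0 in the seminorm, so by
    Cauchy-Schwarz the functional [F], the limit of [s (rep F n)], vanishes on [D]. *)
Lemma cinner_eq0 F : cinner F F = 0 -> F = 0.
Proof.
move=> FF0; apply: completionP => x Dx.
have := @cvg_rep_cinner _ _ _ F F; rewrite FF0 => /cvg_sqrtC0 rep0.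
have {}rep0 := rep0 (fun n => si_ge0 (repP F n).1).
apply: (@cvg_unique_complex _ (fun=> F x)); first exact: cvg_cst.
apply: (norm_cvg_le (b := fun n => n.+1%:R^-1 * N x + N (rep F n) * N x)).
  move=> n; have [DF Fx] := repP F n.
  rewrite subr0 -(subrK (s (rep F n) x) (F x)) (le_trans (ler_normD _ _))//.
  rewrite lerD ?Fx//.
  exact: cauchy_schwarz_sqrt (si_sesqui s) (@si_ge0 _ _ s) _ _ _ _.
rewrite [X in _ --> X](_ : _ = 0 * N x + 0 * N x); last by ring.
exact: (cvgD (cvgM inv0 (@cvg_cst _ _ _ _ _)) (cvgM rep0 (@cvg_cst _ _ _ _ _))).
Qed.

HB.instance Definition _ := @bilinear_isBilinear.Build _ _ _ _ *%R
  (Num.conj \; *%R) (@cinner R V s)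
  (cinner_linear, cinner_linear_r).
HB.instance Definition _ := @isHermitianSesquilinear.Build _ _ false
  (@Num.conj R[i]) (@cinner R V s) (fun F G => etrans (cinner_conj F G) (esym (mul1r _))).

Lemma cinner_gt0 F : F != 0 -> 0 < cinner F F.
Proof.
move=> F0; rewrite lt_def cinner_ge0 andbT.
by apply: contra_neq F0; apply: cinner_eq0.
Qed.

HB.instance Definition _ := isDotProduct.Build _ _ (@cinner R V s) cinner_gt0.

Let cnorm F := sqrtC (cinner F F).

Let cinner_sesqui : sesqui_on setT (@cinner R V s).
Proof. by split=> // *; rewrite (cinner_linear, cinner_linear_r). Qed.

Let cnormD F G : cnorm (F + G) <= cnorm F + cnorm G.
Proof. exact: ler_sqrt_formD cinner_sesqui (fun F _ => cinner_ge0 F) _ _ I I. Qed.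

Let cnormZ a F : cnorm (a *: F) = `|a| * cnorm F.
Proof. exact: sqrt_formZ cinner_sesqui _ _ I. Qed.

Let cnorm_eq0 F : cnorm F = 0 -> F = 0.
Proof. by move/eqP; rewrite sqrtC_eq0 => /eqP; apply: cinner_eq0. Qed.

HB.instance Definition _ := Lmodule_isNormed.Build R[i] (completion s)
  cnormD cnormZ cnorm_eq0.

End CompletionHilbert.

(** * The embedding into the completion, and completeness *)

Section CompletionComplete.
Context (R : realType) (V : lmodType R[i]) (s : semi_inner V).

Notation D := (sidom s).
Local Notation N x := (sqrtC (s x x)).
Let D_sub : Defs.subspace D. Proof. by case: (si_sesqui s). Qed.
Let sN_ge0 x : D x -> 0 <= N x. Proof. by move=> /si_ge0; rewrite sqrtC_ge0. Qed.
Let s_cs x y : D x -> D y -> `|s x y| <= N x * N y.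
Proof. exact: cauchy_schwarz_sqrt (si_sesqui s) (@si_ge0 _ _ s) _ _. Qed.

Implicit Types (F G : completion s) (x y : V).

Let inv_ge0 n : 0 <= n.+1%:R^-1 :> R[i]. Proof. by rewrite invr_ge0. Qed.
Let inv0 := @cvg_invn R.

Lemma completion_norm F : `|F| ^+ 2 = cinner F F.
Proof. exact: sqrtCK. Qed.

Let embed_fun x y := if `[< D y >] then s x y else 0.

Let embed_approx x : D x -> approx s (embed_fun x) x 0.
Proof.
move=> Dx; split=> // y Dy; rewrite /embed_fun asboolT// subrr normr0 mul0r//.
Qed.

Let embed_completable x : D x -> embed_fun x \in completable s.
Proof.
move=> Dx; apply/asboolP; split=> [y nDy|e e0].
  by rewrite /embed_fun asboolF.
by exists x; apply: approxW (embed_approx Dx); apply: ltW.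
Qed.

(** The value 0 outside [D] is a default; a total function is wanted for the map of an
    [operator]. *)
Definition embed x : completion s :=
  if pselect (D x) is left Dx then Completion (embed_completable Dx) else 0.

Lemma approx_embed x : D x -> approx s (embed x) x 0.
Proof.
by move=> Dx; rewrite /embed; case: pselect => // Dx'; apply: embed_approx.
Qed.

Lemma embedE x y : D x -> D y -> embed x y = s x y.
Proof.
move=> Dx Dy; have [_ /(_ y Dy)] := approx_embed Dx.
by rewrite mul0r normr_le0 subr_eq0 => /eqP.
Qed.

Lemma cinner_embed x y : D x -> D y -> cinner (embed x) (embed y) = s x y.
Proof.
move=> Dx Dy; apply: (@cvg_unique_complex _ (fun=> s x y)); last exact: cvg_cst.
apply: (cvg_cinner (e := fun=> 0) (e' := fun=> 0)) => // [n|n||].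
- exact: approx_embed.
- exact: approx_embed.
- exact: cvg_cst.
- exact: cvg_cst.
Qed.

Lemma embed_linear a x y : D x -> D y -> embed (a *: x + y) = a *: embed x + embed y.
Proof.
move=> Dx Dy; apply: completionP => z Dz.
rewrite [RHS](_ : _ = a * embed x z + embed y z)// !embedE//.
  by case: (si_sesqui s) => _ ->.
by case: D_sub => _; apply.
Qed.

Lemma embedB x y : D x -> D y -> embed (x - y) = embed x - embed y.
Proof.
by move=> Dx Dy; rewrite addrC -scaleN1r embed_linear// scaleN1r addrC.
Qed.

Lemma norm_embed x : D x -> `|embed x| = N x.
Proof. by move=> Dx; rewrite -[LHS]/(sqrtC _) cinner_embed. Qed.

(** Links the dual-norm error to the norm: that of [F - embed x] is the limit of the seminorms of
    [rep F n - x], which [approx_dist] bounds by [n.+1%:R^-1 + e]. *)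
Lemma approx_norm F x (e : R[i]) : 0 <= e -> approx s F x e -> `|F - embed x| <= e.
Proof.
move=> e_ge0 Fx; have [Dx _] := Fx.
rewrite -(@ler_pXn2r _ 2)// ?nnegrE// completion_norm -subr_ge0.
have Drx n : D (rep F n - x) by have [DF _] := repP F n; apply: subspaceB.
have inve : (n.+1%:R^-1 + e : R[i]^o) @[n --> \oo] --> (e : R[i]^o).
  rewrite -[e in X in _ --> X]add0r; exact: (cvgD inv0 (@cvg_cst _ _ _ _ _)).
have lim1 : ((n.+1%:R^-1 + e) ^+ 2 - s (rep F n - x) (rep F n - x) : R[i]^o)
    @[n --> \oo] --> (e ^+ 2 - cinner (F - embed x) (F - embed x) : R[i]^o).
  apply: cvgB.
    exact: (cvgM inve inve).
  apply: (cvg_cinner (e := fun n => n.+1%:R^-1) (e' := fun n => n.+1%:R^-1)) => //.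
  - move=> n; rewrite (_ : F - _ = (-1) *: embed x + F); last by rewrite scaleN1r addrC.
    rewrite (_ : rep F n - x = (-1) *: x + rep F n); last by rewrite scaleN1r addrC.
    rewrite -[_^-1]add0r -(mulr0 `|-1|).
    exact: approx_linear (approx_embed Dx) (repP F n).
  - move=> n; rewrite (_ : F - _ = (-1) *: embed x + F); last by rewrite scaleN1r addrC.
    rewrite (_ : rep F n - x = (-1) *: x + rep F n); last by rewrite scaleN1r addrC.
    rewrite -[_^-1]add0r -(mulr0 `|-1|).
    exact: approx_linear (approx_embed Dx) (repP F n).
apply: cvg_complex_ge0 lim1; apply: nearW => n; rewrite subr_ge0 -[leLHS]sqrtCK.
rewrite ler_pXn2r ?nnegrE ?addr_ge0 ?sN_ge0//.
exact: approx_dist (repP F n) Fx.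
Qed.

(** Each [F n] is replaced by a vector [x n] of [D] at distance at most [n.+1%:R^-1]. These vectors
    are Cauchy in the seminorm, and the limit is the pointwise limit of the functionals
    [s (x n)]. *)
Lemma completion_complete (F : nat -> completion s) :
  cauchy_seq F -> exists G : completion s, F @ \oo --> G.
Proof.
move=> F_cauchy; pose x n := rep (F n) n.
have Fx n : approx s (F n) (x n) n.+1%:R^-1 by apply: repP.
have Dx n : D (x n) by case: (Fx n).
have Fxn n : `|F n - embed (x n)| <= n.+1%:R^-1 by apply: approx_norm.
have x_cauchy (e : R[i]) : 0 < e -> exists M, forall n m, (M <= n)%N -> (M <= m)%N ->
    N (x n - x m) <= e.
  move=> e0; have e30 : 0 < e / 3 by rewrite divr_gt0.
  have [M1 FM1] := F_cauchy _ e30; have [M2 iM2] := invn_lt e30.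
  exists (maxn M1 M2) => n m; rewrite !geq_max => /andP[n1 n2] /andP[m1 m2].
  rewrite -norm_embed; last exact: subspaceB.
  rewrite embedB//.
  have -> : embed (x n) - embed (x m) =
      (embed (x n) - F n) + ((F n - F m) + (F m - embed (x m))).
    by rewrite !subrKA.
  rewrite (le_trans (ler_normD _ _))//.
  rewrite (_ : e = e / 3 + (e / 3 + e / 3)); last by field.
  rewrite lerD//; first by rewrite distrC (le_trans (Fxn n))// ltW// iM2.
  rewrite (le_trans (ler_normD _ _))// lerD//; first by rewrite ltW// FM1.
  by rewrite (le_trans (Fxn m))// ltW// iM2.
have lim y : exists z : R[i],
    (D y -> (s (x n) y : R[i]^o) @[n --> \oo] --> (z : R[i]^o)) /\ (~ D y -> z = 0).
  have [Dy|nDy] := pselect (D y); last by exists 0.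
  have Ny1 : 0 < N y + 1 by rewrite ltr_wpDl ?sN_ge0.
  have [|z xz] := @complex_cauchy_cvg R (fun n => s (x n) y); last by exists z.
  move=> e e0; have [M xM] := x_cauchy (e / (N y + 1)) (divr_gt0 e0 Ny1).
  exists M => n m Mn Mm; rewrite -(sesquiBl (si_sesqui s))//.
  rewrite (le_lt_trans (s_cs (subspaceB D_sub (Dx n) (Dx m)) Dy))//.
  rewrite (le_lt_trans (ler_wpM2r (sN_ge0 Dy) (xM _ _ Mn Mm)))//.
  by rewrite mulrAC ltr_pdivrMr// ltr_pM2l// ltrDl.
have [g g_lim] := choice lim.
have gP y := (g_lim y).1.
(* The Cauchy bound on [s (x m) y - s (x n) y] is uniform in [m], so it survives the limit in
   [m]. *)
have gx (e : R[i]) : 0 < e -> exists M, forall n, (M <= n)%N -> approx s g (x n) e.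
  move=> e0; have [M xM] := x_cauchy _ e0; exists M => n Mn; split=> // y Dy.
  have dist_lim : (e * N y - `|s (x m) y - s (x n) y| : R[i]^o) @[m --> \oo] -->
      (e * N y - `|g y - s (x n) y| : R[i]^o).
    exact: (cvgB (@cvg_cst _ _ _ _ _)
      (cvg_norm (cvgB (gP y Dy) (@cvg_cst _ _ _ _ _)))).
  rewrite -subr_ge0; apply: cvg_complex_ge0 dist_lim; exists M => // m /= Mm.
  rewrite subr_ge0 -(sesquiBl (si_sesqui s))//.
  rewrite (le_trans (s_cs (subspaceB D_sub (Dx m) (Dx n)) Dy))//.
  by rewrite ler_wpM2r ?sN_ge0// xM.
have g_completable : g \in completable s.
  apply/asboolP; split=> [y nDy|e /gx[M /(_ M (leqnn M))]].
    exact: (g_lim y).2.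
  by exists (x M).
pose G : completion s := Completion g_completable.
exists G; apply/cvgrPdist_lt => e e0.
have e20 : 0 < e / 2 by rewrite divr_gt0.
have [M1 gM1] := gx _ e20; have [M2 iM2] := invn_lt e20.
exists (maxn M1 M2) => // n /=; rewrite geq_max => /andP[n1 n2].
rewrite -(subrKA (embed (x n))) (le_lt_trans (ler_normD _ _))//.
rewrite (splitr e) ler_ltD//; first exact: (@approx_norm G _ _ (ltW e20) (gM1 n n1)).
by rewrite distrC (le_lt_trans (Fxn n))// iM2.
Qed.

HB.instance Definition _ := Uniform_isComplete.Build (completion s)
  (seq_complete completion_complete).

HB.instance Definition _ := CompleteNormedModule_isHilbert.Build R (completion s)
  completion_norm.

End CompletionComplete.

(** * Representing maps *)

Section ShiftedForm.
Context (R : realType) (H : hilbertType R) (t : sform H) (c : R).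
Hypotheses (t_form : sesquilinear t) (t_ge : bounded_below_by t c).

Lemma shifted_form_sesqui :
  sesqui_on (sdom t) (fun x y => t x y - c%:C%C * inner x y).
Proof.
have [t_sub t_l t_r] := t_form.
have c_conj : (c%:C%C)^*%R = c%:C%C by apply/CrealP/complex_realP; exists c.
by split=> // a x y z Dx Dy Dz; rewrite ?t_l// ?t_r// ?linearPl ?linearPr/=; ring.
Qed.

Lemma shifted_form_ge0 x : sdom t x -> 0 <= t x x - c%:C%C * inner x x.
Proof. by move=> Dx; rewrite subr_ge0 -normr_inner t_ge. Qed.

Lemma exists_representing_map : exists (K : hilbertType R) (Q : operator H K),
  [/\ linear_operator Q, odom Q = sdom t &
      forall x y, sdom t x -> sdom t y ->
        t x y = c%:C%C * inner x y + inner (Q x) (Q y)].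
Proof.
have [t_sub _ _] := t_form.
pose s := SemiInner shifted_form_sesqui shifted_form_ge0.
exists (completion s), (Operator (sdom t) (@embed _ _ s)).
split=> // [|x y Dx Dy]; first by split=> // a x y Dx Dy; apply: embed_linear.
rewrite [X in _ + X](_ : _ = s x y); last exact: (@cinner_embed _ _ s).
by rewrite addrC subrK.
Qed.

End ShiftedForm.

(** * The closure of the graph of a linear operator *)

Section BiadjointRelation.
Context (R : realType) (H K : hilbertType R) (Q : operator H K).
Hypothesis Q_lin : linear_operator Q.
Implicit Types (f : nat -> H).

Local Notation D := (odom Q).
Local Notation G := (biadjoint Q).
Local Notation M := (rel_mul G).
Local Notation P := (orthoproj M).

Lemma linear_operatorB x y : D x -> D y -> Q (x - y) = Q x - Q y.
Proof.
have [_ Q_l] := Q_lin.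
by move=> Dx Dy; rewrite addrC -scaleN1r Q_l// scaleN1r addrC.
Qed.

Lemma biadjointP (T : operator H K) x y : biadjoint T (x, y) <->
  exists f, [/\ forall n, odom T (f n), f @ \oo --> x & T \o f @ \oo --> y].
Proof.
split=> [/closure_prodP[f [fT fx fy]]|[f [Df fx fy]]]; last first.
  by apply/closure_prodP; exists (fun n => (f n, T (f n))); split=> // n; split=> //=. 
exists (fun n => (f n).1); split=> // [n|]; first by have [] := fT n.
suff -> : T \o (fun n => (f n).1) = (fun n => (f n).2) by [].
by apply/funext => n /=; have [] := fT n.
Qed.

Lemma biadjoint_linear a x x' y y' :
  G (x, y) -> G (x', y') -> G (a *: x + x', a *: y + y').
Proof.
have [D_sub Q_l] := Q_lin.
move=> /biadjointP[f [Df fx fy]] /biadjointP[f' [Df' fx' fy']].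
apply/biadjointP; exists (fun n => a *: f n + f' n); split=> [n||].
- exact: (subspaceD D_sub (subspaceZ D_sub _ _)).
- exact: (cvgD (cvgZ (@cvg_cst _ _ _ _ _) fx) fx').
rewrite (_ : _ \o _ = fun n => a *: Q (f n) + Q (f' n)); last first.
  by apply/funext => n /=; rewrite Q_l.
exact: (cvgD (cvgZ (@cvg_cst _ _ _ _ _) fy) fy').
Qed.

Lemma biadjoint_closed (T : operator H K) f (g : nat -> K) x y :
  (forall n, biadjoint T (f n, g n)) -> f @ \oo --> x -> g @ \oo --> y ->
  biadjoint T (x, y).
Proof.
move=> fgT fx gy.
suff : closure (biadjoint T) (x, y) by rewrite -(closure_id _).1//; apply: closed_closure.
by apply/closure_prodP; exists (fun n => (f n, g n)).
Qed.

Lemma biadjoint0 : G (0, 0).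
Proof.
have [D_sub Q_l] := Q_lin; have D0 := subspace0 D_sub.
apply: subset_closure; split=> //=.
by rewrite -[0 in RHS](subrr 0) linear_operatorB// subrr.
Qed.

Lemma rel_mul_subspace : Defs.subspace M.
Proof.
split=> [|a y y' My My']; first exact: biadjoint0.
by have := @biadjoint_linear a _ _ _ _ My My'; rewrite scaler0 addr0.
Qed.

Lemma rel_mul_closed : seq_closed M.
Proof.
by move=> f y Mf fy; apply: (biadjoint_closed Mf) => //; apply: cvg_cst.
Qed.

Let PP := orthoprojP rel_mul_subspace rel_mul_closed.

(** A prescribed accuracy for each [n] allows a diagonal choice when the point of [G] varies with
    [n]. *)
Lemma biadjoint_approx x y n : G (x, y) -> exists u,
  [/\ D u, `|u - x| <= n.+1%:R^-1 & `|Q u - y| <= n.+1%:R^-1].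
Proof.
have inv_gt0 : 0 < n.+1%:R^-1 :> R[i] by rewrite invr_gt0.
move=> /biadjointP[f [Df /cvgrPdist_le/(_ _ inv_gt0) fx /cvgrPdist_le/(_ _ inv_gt0) fy]].
have [m [mx my]] := filter_ex (filterI fx fy).
by exists (f m); split; rewrite // distrC.
Qed.

(* If [Q_reg x_n -> z] then [P0 Q x_n], being in [mul Q**], is close to [Q h_n]
   for some small [h_n], and [x_n - h_n] witnesses [{x, z}] in [Q**]. *)
Lemma biadjoint_reg_part x z : biadjoint (reg_part Q) (x, z) <->
  G (x, z) /\ forall w, M w -> inner z w = 0.
Proof.
have [D_sub _] := Q_lin; split=> [/biadjointP[f /= [Df fx fz]]|[]].
  split=> [|w Mw]; last first.
    apply: (@cvg_unique_complex _ (fun n => inner (reg_part Q (f n)) w)).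
      by apply: cvg_inner fz _; apply: cvg_cst.
    rewrite (_ : (fun n => _) = (fun=> 0)); first exact: cvg_cst.
    by apply/funext => n; apply: (PP (Q (f n))).2.
  have [h hP] := choice (fun n => biadjoint_approx n (PP (Q (f n))).1).
  apply/biadjointP; exists (fun n => f n - h n).
  have Dh n : D (h n) by have [] := hP n.
  split=> [n||]; first exact: subspaceB.
    apply: (cvg_norm_close (b := fun n => n.+1%:R^-1)) (@cvg_invn R) fx => n.
    by rewrite addrAC subrr add0r normrN; have [_] := hP n; rewrite subr0.
  apply: (cvg_norm_close (b := fun n => n.+1%:R^-1)) (@cvg_invn R) fz => n /=.
  rewrite linear_operatorB// opprB addrC addrA subrK distrC.
  by have [_ _] := hP n.
move=> /biadjointP[f [Df fx fz]] zM; apply/biadjointP; exists f; split=> //.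
(* Conversely, for [z] orthogonal to [M] the projections of [Q (f n)] tend to [P z = 0], so
   subtracting them leaves the limit unchanged. *)
have := cvg_orthoproj rel_mul_subspace rel_mul_closed fz.
rewrite orthoproj_orthogonal//; last 2 first.
- exact: rel_mul_subspace.
- exact: rel_mul_closed.
by move=> Pfz; rewrite -[z]subr0; exact: (cvgB fz Pfz).
Qed.

(** A vector of the left side lies in [M] and is orthogonal to [M]. *)
Lemma rel_mul_reg_part : rel_mul (biadjoint (reg_part Q)) = [set 0].
Proof.
apply/seteqP; split=> [z /biadjoint_reg_part[Mz zM]|_ ->]/=.
  by apply/eqP; rewrite -normr_eq0 -sqrf_eq0 normr_inner zM.
by apply/biadjoint_reg_part; split=> [|w Mw]; [exact: biadjoint0|rewrite linear0l].
Qed.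

Lemma biadjoint_reg_partB x y : G (x, y) -> biadjoint (reg_part Q) (x, y - P y).
Proof.
move=> Gxy; apply/biadjoint_reg_part; split; last exact: (PP y).2.
have := @biadjoint_linear (-1) _ _ _ _ (PP y).1 Gxy.
by rewrite scaler0 add0r scaleN1r addrC.
Qed.

Lemma rel_dom_reg_part : rel_dom (biadjoint (reg_part Q)) = rel_dom G.
Proof.
apply/seteqP; split=> x [y]; first by move=> /biadjoint_reg_part[Gxy _]; exists y.
by move=> /biadjoint_reg_partB; exists (y - P y).
Qed.

Local Notation Qregc := (rel_operator (biadjoint (reg_part Q))).

(** Shows that the choice in [rel_operator] is harmless: two values at [x] differ by a vector of
    [M], and both are orthogonal to [M]. *)
Lemma reg_closureP x z : biadjoint (reg_part Q) (x, z) <-> odom Qregc x /\ Qregc x = z.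
Proof.
split=> [Gxz|[[y Gxy] <-]]; last first.
  by apply: (@xgetPex _ 0 [set y | biadjoint (reg_part Q) (x, y)]); exists y.
split; first by exists z.
have /biadjoint_reg_part[Gxy yM] :
    [set y | biadjoint (reg_part Q) (x, y)] (Qregc x).
  by apply: xgetPex; exists z.
have /biadjoint_reg_part[{}Gxz zM] := Gxz.
apply/eqP; rewrite -subr_eq0 -normr_eq0 -sqrf_eq0 normr_inner.
have M_d : M (Qregc x - z).
  have := @biadjoint_linear (-1) _ _ _ _ Gxz Gxy.
  by rewrite !scaleN1r addNr addrC.
by rewrite {1}linearBl/= yM// zM// subrr.
Qed.

Lemma reg_closure_linear : linear_operator Qregc.
Proof.
have Greg_linear a x y : odom Qregc x -> odom Qregc y ->
    biadjoint (reg_part Q) (a *: x + y, a *: Qregc x + Qregc y).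
  move=> Dx Dy; have [/biadjoint_reg_part[Gx xM] /biadjoint_reg_part[Gy yM]] :=
    (((reg_closureP _ _).2 (conj Dx erefl)), ((reg_closureP _ _).2 (conj Dy erefl))).
  apply/biadjoint_reg_part; split; first exact: biadjoint_linear.
  by move=> w Mw; rewrite linearPl/= xM// yM// mulr0 addr0.
split=> [|a x y Dx Dy]; last by have /reg_closureP[] := Greg_linear a x y Dx Dy.
split=> [|a x y Dx Dy]; last by have /reg_closureP[] := Greg_linear a x y Dx Dy.
exists 0; suff : rel_mul (biadjoint (reg_part Q)) 0 by [].
by rewrite rel_mul_reg_part.
Qed.

Lemma reg_closure_extends x : D x -> odom Qregc x /\ Qregc x = reg_part Q x.
Proof. by move=> Dx; apply/reg_closureP; apply: subset_closure. Qed.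

End BiadjointRelation.

(** * Forms given by an operator *)

Section OperatorForm.
Context (R : realType) (H K : hilbertType R) (c : R) (T : operator H K).
Hypothesis T_lin : linear_operator T.

(** Stated for a general operator, as it is applied both to [Q_reg] and to its closure. *)
Definition op_form : sform H :=
  SForm (odom T) (fun x y => c%:C%C * inner x y + inner (T x) (T y)).

Lemma op_formE x y : op_form x y = c%:C%C * inner x y + inner (T x) (T y).
Proof. by []. Qed.

Lemma op_form_sesquilinear : sesquilinear op_form.
Proof.
have [T_sub T_l] := T_lin.
have c_conj : (c%:C%C)^*%R = c%:C%C by apply/CrealP/complex_realP; exists c.
by split=> // a x y z Dx Dy Dz /=; rewrite T_l// ?linearPl ?linearPr/=; ring.
Qed.

Lemma op_form_bounded : bounded_below_by op_form c.
Proof. by move=> x _; rewrite /= normr_inner lerDl inner_ge0. Qed.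

Lemma op_form_dist (f : nat -> H) n m : odom T (f n) -> odom T (f m) ->
  op_form (f n - f m) (f n - f m) =
  c%:C%C * `|f n - f m| ^+ 2 + `|T (f n) - T (f m)| ^+ 2.
Proof. by move=> Dn Dm; rewrite /= linear_operatorB// -!normr_inner. Qed.

Lemma scaled_cauchy_seq_norm2 (f : nat -> H) (e : R[i]) :
  cauchy_seq f -> 0 < e -> exists N, forall n m,
    (N <= n)%N -> (N <= m)%N -> `|c%:C%C * `|f n - f m| ^+ 2| < e.
Proof.
(* The summand 1 allows for [c = 0]. *)
move=> f_cauchy e0; have c1 : 0 < `|c%:C%C| + 1 :> R[i] by rewrite ltr_wpDl.
have [N fN] := cauchy_seq_norm2 f_cauchy (divr_gt0 e0 c1).
exists N => n m Nn Nm; rewrite normrM [X in _ * X]ger0_norm ?exprn_ge0//.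
have := fN n m Nn Nm; rewrite ltr_pdivlMr// mulrC; apply: le_lt_trans.
by rewrite mulrDl mul1r lerDl exprn_ge0.
Qed.

(** Once [f] converges, the term with [c] tends to 0 whatever the sign of [c]. The remaining
    condition says that [T \o f] is Cauchy, hence convergent since [K] is complete. *)
Lemma form_cvg_op_form f x : form_cvg op_form f x <->
  [/\ forall n, odom T (f n), f @ \oo --> x & exists z : K, T \o f @ \oo --> z].
Proof.
split=> [[Df fx /cvg_pairP f_cauchy]|[Df fx [z Tfz]]]; split=> //.
  apply: cauchy_seq_cvg => e e0.
  have e20 : 0 < e ^+ 2 / 2 by rewrite divr_gt0// exprn_gt0.
  have [N1 N1e] := f_cauchy _ e20.
  have [N2 N2e] := scaled_cauchy_seq_norm2 (cvg_cauchy_seq fx) e20.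
  exists (maxn N1 N2) => n m; rewrite !geq_max => /andP[n1 n2] /andP[m1 m2].
  rewrite -(@ltr_pXn2r _ 2)// ?nnegrE ?(ltW e0)// -[ltLHS]ger0_norm ?exprn_ge0//.
  have h1 : `|op_form (f n - f m) (f n - f m)| < e ^+ 2 / 2 := N1e n m n1 m1.
  rewrite (op_form_dist (Df n) (Df m)) in h1.
  rewrite (_ : `|_| ^+ 2 = c%:C%C * `|f n - f m| ^+ 2 + `|T (f n) - T (f m)| ^+ 2
    - c%:C%C * `|f n - f m| ^+ 2); last by rewrite /= addrAC subrr add0r.
  rewrite (le_lt_trans (ler_normB _ _))// [ltRHS]splitr ltrD//.
  exact: N2e.
apply/cvg_pairP => e e0; have e20 : 0 < e / 2 by rewrite divr_gt0.
have [N1 N1e] := scaled_cauchy_seq_norm2 (cvg_cauchy_seq fx) e20.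
have [N2 N2e] := cauchy_seq_norm2 (cvg_cauchy_seq Tfz) e20.
exists (maxn N1 N2) => n m; rewrite !geq_max => /andP[n1 n2] /andP[m1 m2].
rewrite (op_form_dist (Df n) (Df m)) (le_lt_trans (ler_normD _ _))// [ltRHS]splitr ltrD//.
  exact: N1e.
by rewrite ger0_norm ?exprn_ge0//; apply: N2e.
Qed.

Lemma cvg_op_form0 f : f @ \oo --> 0 -> T \o f @ \oo --> 0 ->
  (op_form (f n) (f n) : R[i]^o) @[n --> \oo] --> (0 : R[i]^o).
Proof.
move=> f0 Tf0; have e : (0 : R[i]) = c%:C%C * inner (0 : H) 0 + inner (0 : K) 0.
  by rewrite !linear0r mulr0 addr0.
rewrite [X in _ --> X]e.
exact: (cvgD (cvgM (@cvg_cst _ _ _ _ _) (cvg_inner f0 f0)) (cvg_inner Tf0 Tf0)).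
Qed.

Lemma cvg_op_form_dist f x : (forall n, odom T (f n)) -> odom T x ->
  f @ \oo --> x -> T \o f @ \oo --> T x ->
  (op_form (f n - x) (f n - x) : R[i]^o) @[n --> \oo] --> (0 : R[i]^o).
Proof.
move=> Df Dx fx Tfx; apply: (cvg_op_form0 (f := fun n => f n - x)).
  rewrite -(subrr x); exact: (cvgB fx (@cvg_cst _ _ _ _ _)).
rewrite (_ : _ \o _ = fun n => T (f n) - T x); last first.
  by apply/funext => n /=; rewrite linear_operatorB.
rewrite -(subrr (T x)); exact: (cvgB Tfx (@cvg_cst _ _ _ _ _)).
Qed.

(** The hypothesis is closability of [T]: it identifies the limit of [T \o f] as 0. *)
Lemma op_form_closable :
  (forall f z, (forall n, odom T (f n)) -> f @ \oo --> 0 -> T \o f @ \oo --> z ->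
    z = 0) ->
  closable op_form.
Proof.
move=> T_closable f /form_cvg_op_form[Df f0 [z Tfz]]; apply: cvg_op_form0 => //.
by rewrite -(T_closable f z).
Qed.

Lemma op_form_closed :
  (forall f x z, (forall n, odom T (f n)) -> f @ \oo --> x -> T \o f @ \oo --> z ->
    odom T x /\ T x = z) ->
  form_closed op_form.
Proof.
move=> T_closed f x /form_cvg_op_form[Df fx [z Tfz]].
have [Dx Txz] := T_closed f x z Df fx Tfz; split=> //.
by apply: cvg_op_form_dist; rewrite // Txz.
Qed.

End OperatorForm.

(** * The sum decomposition *)

Section Decomposition.
Context (R : realType) (H : hilbertType R).

(** The form [u - c] is nonnegative, so [cvg_sesqui] applies to it; the term with [c] is continuous
    because [f] and [g] converge in norm. *)
Lemma cvg_semibounded_form (u : sform H) (f g : nat -> H) x y :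
  sesquilinear u -> semibounded u ->
  (forall n, sdom u (f n)) -> (forall n, sdom u (g n)) -> sdom u x -> sdom u y ->
  f @ \oo --> x -> g @ \oo --> y ->
  (u (f n - x) (f n - x) : R[i]^o) @[n --> \oo] --> (0 : R[i]^o) ->
  (u (g n - y) (g n - y) : R[i]^o) @[n --> \oo] --> (0 : R[i]^o) ->
  (u (f n) (g n) : R[i]^o) @[n --> \oo] --> (u x y : R[i]^o).
Proof.
move=> u_form [c u_ge] Df Dg Dx Dy fx gy ufx ugy.
have shift0 (h : nat -> H) z : h @ \oo --> z ->
    (u (h n - z) (h n - z) : R[i]^o) @[n --> \oo] --> (0 : R[i]^o) ->
    (u (h n - z) (h n - z) - c%:C%C * inner (h n - z) (h n - z) : R[i]^o)
      @[n --> \oo] --> (0 : R[i]^o).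
  move=> hz uhz; have hz0 : h n - z @[n --> \oo] --> (0 : H).
    rewrite -(subrr z); exact: (cvgB hz (@cvg_cst _ _ _ _ _)).
  have e : (0 : R[i]) = 0 - c%:C%C * inner (0 : H) 0 by rewrite linear0r mulr0 subr0.
  rewrite [X in _ --> X]e.
  exact: (cvgB uhz (cvgM (@cvg_cst _ _ _ _ _) (cvg_inner hz0 hz0))).
have lim := cvg_sesqui (shifted_form_sesqui c u_form) (shifted_form_ge0 u_ge)
  Df Dg Dx Dy (shift0 _ _ fx ufx) (shift0 _ _ gy ugy).
have -> : (fun n => u (f n) (g n)) = (fun n =>
    (u (f n) (g n) - c%:C%C * inner (f n) (g n)) + c%:C%C * inner (f n) (g n)).
  by apply/funext => n; rewrite subrK.
rewrite -(subrK (c%:C%C * inner x y) (u x y)).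
exact: (cvgD lim (cvgM (@cvg_cst _ _ _ _ _) (cvg_inner fx gy))).
Qed.

Context (K : hilbertType R) (t : sform H) (c : R) (Q : operator H K).
Hypotheses (Q_lin : linear_operator Q) (Q_dom : odom Q = sdom t).
Hypothesis tE : forall x y, sdom t x -> sdom t y ->
  t x y = c%:C%C * inner x y + inner (Q x) (Q y).

Local Notation M := (rel_mul (biadjoint Q)).
Local Notation P := (orthoproj M).
Local Notation Qreg := (reg_part Q).
Local Notation Qsing := (sing_part Q).
Local Notation Qregc := (rel_operator (biadjoint Qreg)).

Let M_sub := rel_mul_subspace Q_lin.
Let M_closed : seq_closed M := @rel_mul_closed _ _ _ Q.
Let PP := orthoprojP M_sub M_closed.

Lemma reg_part_linear : linear_operator Qreg.
Proof.
have [D_sub Q_l] := Q_lin; split=> // a x y Dx Dy /=.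
by rewrite Q_l// orthoproj_linear// scalerBr opprD addrACA.
Qed.

Lemma sing_part_linear : linear_operator Qsing.
Proof.
by have [D_sub Q_l] := Q_lin; split=> // a x y Dx Dy /=; rewrite Q_l// orthoproj_linear.
Qed.

Lemma inner_reg_sing x y :
  inner (Q x) (Q y) = inner (Qreg x) (Qreg y) + inner (Qsing x) (Qsing y).
Proof.
have innerDD (a b p q : K) : inner a q = 0 -> inner b p = 0 ->
    inner (a + p) (b + q) = inner a b + inner p q.
  move=> aq bp; rewrite linearDl/= !linearDr/= aq -(inner_conj b p) bp.
  by rewrite rmorph0 addr0 add0r.
rewrite -{1}(subrK (P (Q x)) (Q x)) -{1}(subrK (P (Q y)) (Q y)).
by apply: innerDD; apply: (PP _).2; apply: (PP _).1.
Qed.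

Let treg := op_form c Qreg.
Let tsing : sform H := SForm (odom Q) (fun x y => inner (Qsing x) (Qsing y)).

Lemma sing_form_singular : singular tsing.
Proof.
have [D_sub _] := Q_lin; move=> x /= Dx.
have /biadjointP[h [Dh h0 Qh]] := (PP (Q x)).1.
exists (fun n => x - h n); split=> [n||]; first exact: subspaceB.
  rewrite -[x in X in _ --> X]subr0; exact: (cvgB (@cvg_cst _ _ _ _ _) h0).
have PQ0 : P (Q (x - h n)) @[n --> \oo] --> (0 : K).
  have -> : (fun n => P (Q (x - h n))) = (fun n => P (Q x) - (P \o (Q \o h)) n).
    by apply/funext => n /=; rewrite linear_operatorB// orthoprojB.
  (* Continuity of [P] gives the limit [P (P (Q x))] for the subtracted term, and this is
     [P (Q x)]. *)
  rewrite -(subrr (P (Q x))) -[in X in _ - X](orthoproj_id M_sub M_closed (PP (Q x)).1).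
  exact: (cvgB (@cvg_cst _ _ _ _ _) (cvg_orthoproj M_sub M_closed Qh)).
have e : (0 : R[i]) = inner (0 : K) 0 by rewrite linear0r.
rewrite [X in _ --> X]e; exact: (cvg_inner PQ0 PQ0).
Qed.

Lemma reg_form_closable : closable treg.
Proof.
apply: (op_form_closable reg_part_linear) => f z Df f0 Qfz.
have : rel_mul (biadjoint Qreg) z by apply/biadjointP; exists f.
by rewrite rel_mul_reg_part.
Qed.

Lemma reg_sing_decomposition : sum_decomposition t treg tsing.
Proof.
have sing_form : sesquilinear tsing.
  have [D_sub P_l] := sing_part_linear.
  by split=> // a x y z Dx Dy Dz; have /= -> := P_l a x y Dx Dy;
    rewrite ?linearPl ?linearPr.
split.
- split=> [|x y Dx Dy] /=; first by rewrite setIid.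
  by rewrite tE// inner_reg_sing addrA.
- by split.
- split; last exact: reg_form_closable.
    exact: op_form_sesquilinear reg_part_linear.
  by exists c; apply: op_form_bounded.
split=> // [x Dx|]; last exact: sing_form_singular.
exact: inner_ge0.
Qed.

Lemma reg_form_closure : is_form_closure (op_form c Qregc) treg.
Proof.
have c_lin := reg_closure_linear Q_lin.
have c_form := op_form_sesquilinear c c_lin.
have c_semi : semibounded (op_form c Qregc) by exists c; apply: op_form_bounded.
have c_ext x : odom Q x -> odom Qregc x /\ Qregc x = Qreg x.
  exact: reg_closure_extends.
split=> // [||u u_form u_semi u_closed [u_dom u_ext]].
- apply: (op_form_closed c_lin) => f x z Df fx Tfz; apply/(reg_closureP Q_lin).
  by apply: biadjoint_closed fx Tfz => n; apply/(reg_closureP Q_lin).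
- split=> [x /c_ext[]//|x y Dx Dy].
  by rewrite /treg !op_formE (c_ext _ Dx).2 (c_ext _ Dy).2.
(* A sequence in the domain of [Q] realizing [Qregc x] is Cauchy for [treg], hence for [u], which
   agrees with [treg] there. As [u] is closed, the sequence converges to [x] for [u] too. *)
have approx x : odom Qregc x -> exists f : nat -> H,
    [/\ forall n, odom Q (f n), f @ \oo --> x, sdom u x,
      (u (f n - x) (f n - x) : R[i]^o) @[n --> \oo] --> (0 : R[i]^o) &
      (op_form c Qregc (f n - x) (f n - x) : R[i]^o) @[n --> \oo] --> (0 : R[i]^o)].
  move=> Dx; have /biadjointP[f [/= Df fx Qfx]] :
    biadjoint Qreg (x, Qregc x) by apply/(reg_closureP Q_lin).
  have treg_f : form_cvg treg f x.
    by apply/(form_cvg_op_form _ reg_part_linear); split=> //; exists (Qregc x).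
  have [_ _ treg_cauchy] := treg_f.
  have [Dux ufx] : sdom u x /\
      (u (f n - x) (f n - x) : R[i]^o) @[n --> \oo] --> (0 : R[i]^o).
    apply: u_closed; split=> // [n|]; first exact/u_dom/Df.
    have [D_sub _] := Q_lin.
    rewrite (_ : (fun p => _) = (fun p : nat * nat =>
      treg (f p.1 - f p.2) (f p.1 - f p.2)))//.
    by apply/funext => p; apply: u_ext; apply: (subspaceB D_sub).
  exists f; split=> //; apply: (cvg_op_form_dist c c_lin) => //.
    by move=> n; have [] := c_ext _ (Df n).
  rewrite (_ : Qregc \o f = Qreg \o f)//.
  by apply/funext => n; have [_] := c_ext _ (Df n).
split=> [x /approx[f []]//|x y Dx Dy].
have [f [Df fx Dux ufx cfx]] := approx x Dx.
have [g [Dg gy Duy ugy cgy]] := approx y Dy.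
have Duf n := u_dom _ (Df n); have Dug n := u_dom _ (Dg n).
have Dcf n := (c_ext _ (Df n)).1; have Dcg n := (c_ext _ (Dg n)).1.
(* The values of [u] and of the candidate closure at [x], [y] are limits of the same sequence, the
   values of [treg] at [f n], [g n]. *)
apply: cvg_unique_complex (cvg_semibounded_form u_form u_semi Duf Dug Dux Duy fx gy ufx ugy) _.
rewrite (_ : (fun n => _) = fun n => op_form c Qregc (f n) (g n)).
  exact: (cvg_semibounded_form c_form c_semi Dcf Dcg Dx Dy fx gy cfx cgy).
apply/funext => n; rewrite (u_ext _ _ (Df n) (Dg n)).
by rewrite /treg !op_formE (c_ext _ (Df n)).2 (c_ext _ (Dg n)).2.
Qed.

End Decomposition.

Local Open Scope complex_scope.

Theorem theorem3p1 (R : realType) (H : hilbertType R) (t : sform H)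
    (t_form : sesquilinear t)
    (t_nontrivial : exists2 x : H, sdom t x & x != 0)
    (t_semibounded : semibounded t) :
  (exists treg tsing : sform H, sum_decomposition t treg tsing) /\
  forall (c : R) (K : hilbertType R) (Q : operator H K),
    c <= lower_bound t ->
    linear_operator Q ->
    odom Q = sdom t ->
    (forall x y : H, sdom t x -> sdom t y ->
      t x y = c%:C * inner x y + inner (Q x) (Q y)) ->
    let Qreg := reg_part Q in
    let Qsing := sing_part Q in
    let Qregc := rel_operator (biadjoint Qreg) in
    let treg := SForm (odom Q)
      (fun x y => c%:C * inner x y + inner (Qreg x) (Qreg y)) in
    let tsing := SForm (odom Q) (fun x y => inner (Qsing x) (Qsing y)) in
    let treg_closure := SForm (rel_dom (biadjoint Q))
      (fun x y => c%:C * inner x y + inner (Qregc x) (Qregc y)) in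
    [/\ sum_decomposition t treg tsing,
        (* [biadjoint Qreg] is the graph of [Qregc], with the domain used in
           [treg_closure] *)
        rel_mul (biadjoint Qreg) = [set 0],
        odom Qregc = rel_dom (biadjoint Q) &
        is_form_closure treg_closure treg].
Proof.
split=> [|c K Q _ Q_lin Q_dom tE Qreg Qsing Qregc treg tsing treg_closure].
  have [c t_ge] := t_semibounded.
  have [K [Q [Q_lin Q_dom tE]]] := exists_representing_map t_form t_ge.
  by exists (op_form c (reg_part Q)); eexists; apply: reg_sing_decomposition tE.
split.
- exact: reg_sing_decomposition.
- exact: rel_mul_reg_part.
- exact: rel_dom_reg_part.
(* The closure just obtained lives on the domain of the closed graph of [Qreg], which equals that of
   [biadjoint Q]. *)
have := reg_form_closure c Q_lin.
by rewrite /op_form [odom (rel_operator _)](rel_dom_reg_part Q_lin).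
Qed.
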